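(* Fix $k\in\mathbb{Z}_{\geq 1}$. The feasible region $P^{\mathrm{Av}(312)}_k$ equals the cycle polytope $P(\mathcal{O}v(k,\mathrm{Av}(312)))$ (viewed inside $\mathbb R^{\mathcal S_k}$). Its dimension is $C_k-C_{k-1}$, where $C_k=\frac{1}{k+1}\binom{2k}{k}$ is the $k$-th Catalan number, and its vertices are exactly the vectors $\vec e_{\mathcal C}$ for $\mathcal C$ ranging over the simple cycles of $\mathcal{O}v(k,\mathrm{Av}(312))$.
   Context: For $n\ge1$, $\mathcal S_n$ is the set of permutations of $[n]$ in one-line notation; by convention $\mathcal S_0$ and $\mathrm{Av}_0(B)$ consist of the empty permutation. For distinct reals $x_1,\dots,x_m$, $\mathrm{std}(x_1,\dots,x_m)$ is the unique $\pi\in\mathcal S_m$ with $\pi(i)<\pi(j)\iff x_i<x_j$; for $I=\{i_1<\dots<i_m\}$, $\mathrm{pat}_I(\sigma)=\mathrm{std}(\sigma(i_1),\dots,\sigma(i_m))$. $\sigma$ avoids $\pi$ if no $I$ has $\mathrm{pat}_I(\sigma)=\pi$; $\mathrm{Av}_n(B)$ is the set of size-$n$ permutations avoiding all elements of $B$, $\mathrm{Av}(B)=\bigcup_{n\ge1}\mathrm{Av}_n(B)$. For $\pi\in\mathcal S_k,\sigma\in\mathcal S_n$, $\mathrm{c\text{-}occ}(\pi,\sigma)$ is the number of intervals $I=\{i,\dots,i+k-1\}\subseteq[n]$ with $\mathrm{pat}_I(\sigma)=\pi$, and $\widetilde{\mathrm{c\text{-}occ}}(\pi,\sigma)=\mathrm{c\text{-}occ}(\pi,\sigma)/n$.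 Feasible region: $P^{\mathrm{Av}(B)}_k$ is the set of $\vec v\in[0,1]^{\mathcal S_k}$ for which there is a sequence $(\sigma^m)$ in $\mathrm{Av}(B)$ with $|\sigma^m|\to\infty$ and $\widetilde{\mathrm{c\text{-}occ}}(\pi,\sigma^m)\to\vec v_\pi$ for all $\pi\in\mathcal S_k$. Overlap graph: $\mathcal{O}v(k,\mathrm{Av}(B))$ is the directed multigraph with vertex set $\mathrm{Av}_{k-1}(B)$ and, for each $\pi\in\mathrm{Av}_k(B)$, one edge labelled $\pi$ from $\mathrm{pat}_{\{1,\dots,k-1\}}(\pi)$ to $\mathrm{pat}_{\{2,\dots,k\}}(\pi)$. A simple cycle is a closed walk with distinct edges and distinct vertices. For a nonempty cycle $\mathcal C$, $\vec e_{\mathcal C}\in\mathbb R^{E}$ has $e$-coordinate (number of occurrences of $e$ in $\mathcal C$)$/|\mathcal C|$; the cycle polytope is $P(G)=\mathrm{conv}\{\vec e_{\mathcal C}:\mathcal C\text{ simple cycle}\}$. Since edges of $\mathcal{O}v(k,\mathrm{Av}(B))$ are in bijection with $\mathrm{Av}_k(B)$, $\mathbb R^{E}=\mathbb R^{\mathrm{Av}_k(B)}$ is identified with the subspace of $\mathbb R^{\mathcal S_k}$ of vectors vanishing outside $\mathrm{Av}_k(B)$. Dimension means dimension of the affine hull. *)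

(* Defs.v *)
From HB Require Import structures.
From mathcomp Require Import all_boot all_order all_algebra all_fingroup.
From mathcomp Require Import all_classical all_reals all_analysis.

Set Implicit Arguments.
Unset Strict Implicit.
Unset Printing Implicit Defensive.

Import Order.TTheory GRing.Theory Num.Theory numFieldNormedType.Exports.
Local Open Scope classical_set_scope.
Local Open Scope ring_scope.

(* One-line notation of s in 'S_n (values shifted to 0..n-1; only the
   relative order matters for patterns). *)
Definition oneline (n : nat) (s : 'S_n) : seq nat :=
  [seq nat_of_ord (s i) | i <- enum 'I_n].

Definition std (s : seq nat) : seq nat :=
  [seq count (fun y => (y < x)%N) s | x <- s].

Definition contains (n : nat) (s : 'S_n) (p : seq nat) : Prop :=
  exists m : seq bool, std (mask m (oneline s)) = p.

Definition p312 : seq nat := [:: 2%N; 0%N; 1%N].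

Definition avoids312 (n : nat) (s : 'S_n) : Prop := ~ contains s p312.

Definition cocc (k n : nat) (pi : 'S_k) (s : 'S_n) : nat :=
  count (fun i => std (take k (drop i (oneline s))) == oneline pi)
        (iota 0 (n.+1 - k)).

Definition feasible (R : realType) (k : nat) : set {ffun 'S_k -> R} :=
  [set v : {ffun 'S_k -> R} | (forall pi, 0 <= v pi <= 1) /\
     exists (ns : nat -> nat) (sg : forall m, 'S_(ns m)),
       (forall m, (0 < ns m)%N /\ avoids312 (sg m)) /\
       (forall N, exists M, forall m, (M <= m)%N -> (N <= ns m)%N) /\
       (forall pi : 'S_k,
          (fun m => (cocc pi (sg m))%:R / (ns m)%:R : R) @ \oo --> v pi)].

Arguments feasible R k : clear implicits.

(* Edges are the pi in Av_k(312); vertices are elements of Av_{k-1}(312),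
   represented by their one-line notation.  Edge pi goes from
   pat_{1..k-1}(pi) to pat_{2..k}(pi). *)
Definition ovsrc (k : nat) (pi : 'S_k) : seq nat := std (take k.-1 (oneline pi)).
Definition ovtgt (k : nat) (pi : 'S_k) : seq nat := std (drop 1 (oneline pi)).

Definition ovrel (k : nat) : rel 'S_k := fun a b => ovtgt a == ovsrc b.

(* A simple cycle of Ov(k, Av(312)): a nonempty cyclic sequence of edges
   e_1 ... e_L (each in Av_k(312)) with tgt(e_i) = src(e_{i+1}) cyclically,
   and pairwise distinct visited vertices (hence distinct edges). *)
Definition simple_cycle (k : nat) (c : seq 'S_k) : Prop :=
  [/\ c <> [::], (forall e, e \in c -> avoids312 e),
      path.cycle (@ovrel k) c & uniq (map (@ovsrc k) c)].
Arguments simple_cycle k c : clear implicits.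

Definition e_cycle (R : realType) (k : nat) (c : seq 'S_k) : {ffun 'S_k -> R} :=
  [ffun pi => (count_mem pi c)%:R / (size c)%:R].
Arguments e_cycle R k c : clear implicits.

Definition conv (R : realType) (V : lmodType R) (S : set V) : set V :=
  [set x | exists (m : nat) (p : 'I_m -> V) (l : 'I_m -> R),
     (forall i, S (p i)) /\ (forall i, 0 <= l i) /\
     \sum_(i < m) l i = 1 /\ x = \sum_(i < m) l i *: p i].

Definition cycle_polytope (R : realType) (k : nat) : set {ffun 'S_k -> R} :=
  conv [set x | exists c, simple_cycle k c /\ x = e_cycle R k c].

Arguments cycle_polytope R k : clear implicits.

Definition aff_indep (R : realType) (V : lmodType R) (m : nat) (p : 'I_m -> V) : Prop :=
  forall c : 'I_m -> R, \sum_(i < m) c i = 0 -> \sum_(i < m) c i *: p i = 0 ->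
    forall i, c i = 0.

Definition affdim (R : realType) (V : lmodType R) (S : set V) (d : nat) : Prop :=
  (exists p : 'I_d.+1 -> V, (forall i, S (p i)) /\ aff_indep p) /\
  (forall p : 'I_d.+2 -> V, (forall i, S (p i)) -> ~ aff_indep p).

Definition is_vertex (R : realType) (V : lmodType R) (K : set V) (x : V) : Prop :=
  K x /\ forall y z (t : R), K y -> K z -> 0 < t < 1 ->
    x = t *: y + (1 - t) *: z -> y = z.

Definition catalan (n : nat) : nat := 'C(n.*2, n) %/ n.+1.

(* Main.v *)
Require Import Defs.
From HB Require Import structures.
From mathcomp Require Import all_boot all_order all_algebra all_fingroup.
From mathcomp Require Import all_classical all_reals all_analysis.
From mathcomp Require Import zify lra.

(* The windows of a 312-avoiding permutation form a walk in the overlap graph,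
   so window frequencies of long permutations are, in the limit, unit flows:
   nonnegative weights on the edges of total mass 1, balanced at every vertex.
   Subtracting simple cycles of the support repeatedly shows that the unit
   flows are exactly the cycle polytope.  Conversely every walk is the sequence
   of windows of a 312-avoiding permutation, because a new last letter can be
   inserted immediately below the smallest letter of the last window that has
   to exceed it; direct sums of long repetitions of simple cycles then realize
   every convex combination.

   A unit flow carried by one simple cycle is constant along it, which gives
   the vertices.  The graph is strongly connected (again by direct sums), hence
   some unit flow is positive on all edges and the dimension is the number of
   edges minus the number of vertices.  Both are Catalan numbers since
   312-avoiding words are the outputs of a stack machine, which obey the ballot
   recursion. *)

Set Implicit Arguments.
Unset Strict Implicit.
Unset Printing Implicit Defensive.

(** * Patterns *)

Lemma size_std s : size (std s) = size s.
Proof. by rewrite size_map. Qed.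

Lemma nth_std s i : i < size s ->
  nth 0 (std s) i = count (fun y => y < nth 0 s i) s.
Proof. by move=> lt_is; rewrite (nth_map 0). Qed.

(** Every letter counted below [s_i] is counted below a larger [s_j], and so is [s_i] itself; hence
    ranks compare as the letters do. *)
Lemma std_ltn s i j : i < size s -> j < size s ->
  (nth 0 (std s) i < nth 0 (std s) j) = (nth 0 s i < nth 0 s j).
Proof.
move=> li lj; rewrite !nth_std //.
have mono x y : x <= y -> count (fun z => z < x) s <= count (fun z => z < y) s.
  by move=> le_xy; apply: sub_count => z /= /leq_trans; apply.
case: (ltnP (nth 0 s i) (nth 0 s j)) => [lt_ij|le_ji]; last first.
  by apply/negbTE; rewrite -leqNgt mono.
apply: leq_trans (mono _ _ lt_ij); rewrite -add1n.
have -> : count (fun z => z < (nth 0 s i).+1) s =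
    count_mem (nth 0 s i) s + count (fun z => z < nth 0 s i) s.
  elim: s {li lj mono lt_ij} (nth 0 s i) => //= z s IHs x.
  by rewrite IHs ltnS leq_eqVlt; case: ltngtP => /=; lia.
by rewrite leq_add2r -has_count has_pred1 mem_nth.
Qed.

(** Turns equality of patterns into order isomorphism position by position, which passes to factors
    at once. *)
Lemma std_eqP s t : std s = std t <-> size s = size t /\
  forall i j, i < size s -> j < size s ->
    (nth 0 s i < nth 0 s j) = (nth 0 t i < nth 0 t j).
Proof.
split=> [eq_st|[eq_sz eq_lt]].
  have eq_sz : size s = size t by rewrite -size_std eq_st size_std.
  split=> // i j li lj.
  by rewrite -[LHS]std_ltn // eq_st std_ltn -?eq_sz.
apply: (@eq_from_nth _ 0); rewrite !size_std // => i li.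
(* Counting positions instead of letters makes the ranks in [s] and [t] comparable term by term. *)
have cnt u x : count (fun y => y < x) u =
    count (fun j => nth 0 u j < x) (iota 0 (size u)).
  by rewrite -{1}(mkseq_nth 0 u) count_map.
rewrite !nth_std -?eq_sz // !cnt -eq_sz; apply: eq_in_count => j.
by rewrite mem_iota add0n => /= lj; rewrite eq_lt.
Qed.

Lemma std_idem s : std (std s) = std s.
Proof. by apply/std_eqP; rewrite size_std; split=> // i j *; rewrite std_ltn. Qed.

Lemma std_take n s t : std s = std t -> std (take n s) = std (take n t).
Proof.
move=> /std_eqP[eq_sz eq_lt]; apply/std_eqP; split.
  by rewrite !size_take eq_sz.
by move=> i j; rewrite !size_take_min => li lj; rewrite !nth_take ?eq_lt; lia.
Qed.

Lemma std_drop n s t : std s = std t -> std (drop n s) = std (drop n t).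
Proof.
move=> /std_eqP[eq_sz eq_lt]; apply/std_eqP; split.
  by rewrite !size_drop eq_sz.
by move=> i j; rewrite !size_drop => li lj; rewrite !nth_drop ?eq_lt; lia.
Qed.

Lemma std_map (f : nat -> nat) s : {mono f : x y / x < y} ->
  std (map f s) = std s.
Proof.
move=> fmono; apply/std_eqP; split; rewrite size_map // => i j li lj.
by rewrite !(nth_map 0) ?fmono.
Qed.

Lemma std_rcons s t x y : std s = std t ->
    (forall i, i < size s -> (nth 0 s i < x) = (nth 0 t i < y) /\
       (x < nth 0 s i) = (y < nth 0 t i)) ->
  std (rcons s x) = std (rcons t y).
Proof.
move=> /std_eqP[eq_sz eq_lt] eq_xy; apply/std_eqP; split.
  by rewrite !size_rcons eq_sz.
move=> i j; rewrite !size_rcons !nth_rcons -eq_sz !ltnS => li lj.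
case: (ltnP i) => [li'|gi]; case: (ltnP j) => [lj'|gj].
- exact: eq_lt.
- have -> : j = size s by lia.
  by rewrite eqxx; case: (eq_xy _ li').
- have -> : i = size s by lia.
  by rewrite eqxx; case: (eq_xy _ lj').
- have -> : i = size s by lia.
  have -> : j = size s by lia.
  by rewrite !ltnn.
Qed.

Lemma std_uniq (s : seq nat) : uniq s -> uniq (std s).
Proof.
move=> us; apply/(uniqP 0) => i j; rewrite !inE size_std => li lj eq_ij.
apply/(uniqP 0 us); rewrite ?inE //.
by have := std_ltn li lj; have := std_ltn lj li; rewrite eq_ij ltnn; case: ltngtP.
Qed.

Lemma std_bound s i : i < size s -> nth 0 (std s) i < size s.
Proof.
move=> li; rewrite nth_std // -(count_predC (fun y => y < nth 0 s i)) -[ltnLHS]addn0.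
rewrite ltn_add2l -has_count; apply/hasP; exists (nth 0 s i).
  exact: mem_nth.
by rewrite /= ltnn.
Qed.

(** Avoidance by positions, stated for arbitrary words so that windows and shifted copies can be
    treated before standardization. *)
Definition av312 (s : seq nat) : Prop := forall i j l, i < j -> j < l ->
  l < size s -> nth 0 s j < nth 0 s l -> nth 0 s l < nth 0 s i -> False.

Lemma av312_iso s t : std s = std t -> av312 s -> av312 t.
Proof.
move=> /std_eqP[eq_sz eq_lt] av i j l lij ljl; rewrite -eq_sz => lls.
by rewrite -!eq_lt; try lia; apply: av.
Qed.

Lemma av312_std s : av312 (std s) <-> av312 s.
Proof. by split; apply: av312_iso; rewrite std_idem. Qed.

Lemma av312_take n s : av312 s -> av312 (take n s).
Proof.
move=> av i j l lij ljl; rewrite size_take_min => lls.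
by rewrite !nth_take; try lia; apply: av; lia.
Qed.

Lemma av312_drop n s : av312 s -> av312 (drop n s).
Proof.
move=> av i j l lij ljl; rewrite size_drop => lls.
by rewrite !nth_drop; apply: av; lia.
Qed.

Lemma av312_iota m n : av312 (iota m n).
Proof. by move=> i j l lij ljl; rewrite size_iota => lls; rewrite !nth_iota; lia. Qed.

(** * Direct sums of words *)

(** The shift is one more than the largest letter of [s], or 0 if [s] is empty, so all of [t] lands
    above [s]. *)
Definition dsum (s t : seq nat) := s ++ map (addn (\max_(x <- s) x.+1)) t.

Lemma dsum_lt (s t : seq nat) x y : x \in s ->
  y \in map (addn (\max_(x <- s) x.+1)) t -> x < y.
Proof.
move=> xs /mapP[z _ ->]; apply: leq_trans (leq_addr _ _).
exact: (@leq_bigmax_seq _ s xpredT (fun x => x.+1)).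
Qed.

Lemma size_dsum s t : size (dsum s t) = size s + size t.
Proof. by rewrite size_cat size_map. Qed.

Lemma dsum_uniq s t : uniq s -> uniq t -> uniq (dsum s t).
Proof.
move=> us ut; rewrite cat_uniq us map_inj_uniq ?ut ?andbT; last exact: addnI.
by apply/hasPn => y ys /=; apply/negP => /dsum_lt/(_ ys); rewrite ltnn.
Qed.

(** A 312 meeting both summands would begin in the lower one and end in the upper one, although its
    first letter is its largest. *)
Lemma av312_dsum s t : av312 s -> av312 t -> av312 (dsum s t).
Proof.
move=> avs avt i j l lij ljl; rewrite size_dsum => lls; rewrite !nth_cat.
case: (ltnP l (size s)) => [ls|sl].
  by rewrite (ltn_trans ljl ls) (ltn_trans lij (ltn_trans ljl ls)); apply: avs.
have lt : l - size s < size t by lia.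
case: (ltnP i (size s)) => [ils|si].
  move=> _; apply/negP; rewrite -leqNgt ltnW //.
  by apply: (@dsum_lt _ t); apply: mem_nth; rewrite ?size_map.
have -> : j < size s = false by lia.
by rewrite !(nth_map 0) ?ltn_add2l; try lia; apply: avt; lia.
Qed.

Lemma std_dsum_drop s t : std (drop (size s) (dsum s t)) = std t.
Proof. by rewrite drop_size_cat // std_map // => x y; rewrite ltn_add2l. Qed.

(** * Permutations as words *)

Lemma size_oneline n (s : 'S_n) : size (oneline s) = n.
Proof. by rewrite size_map size_enum_ord. Qed.

Lemma nth_oneline n (s : 'S_n) (i : 'I_n) : nth 0 (oneline s) i = s i.
Proof. by rewrite (nth_map i) ?size_enum_ord // nth_ord_enum. Qed.

Lemma oneline_inj n : injective (@oneline n).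
Proof.
move=> s t eq_st; apply/permP => i; apply: val_inj.
by rewrite /= -!nth_oneline eq_st.
Qed.

Lemma oneline_uniq n (s : 'S_n) : uniq (oneline s).
Proof.
rewrite map_inj_in_uniq ?enum_uniq // => i j _ _ /val_inj.
exact: perm_inj.
Qed.

Lemma oneline_perm n (s : 'S_n) : perm_eq (oneline s) (iota 0 n).
Proof.
apply: uniq_perm; rewrite ?oneline_uniq ?iota_uniq //.
have sub : {subset oneline s <= iota 0 n}.
  by move=> x /mapP[i _ ->]; rewrite mem_iota ltn_ord.
apply: (uniq_min_size _ sub _).2; rewrite ?oneline_uniq //.
by rewrite size_oneline size_iota.
Qed.

Lemma std_perm_iota n s : perm_eq s (iota 0 n) -> std s = s.
Proof.
move=> eq_s; apply: (@eq_from_nth _ 0); rewrite ?size_std // => i li.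
rewrite nth_std // (seq.permP eq_s).
have : nth 0 s i \in iota 0 n by rewrite -(perm_mem eq_s) mem_nth.
rewrite mem_iota /=; move: (nth 0 s i) => v lv.
rewrite -size_filter (_ : n = v + (n - v)); last by lia.
rewrite iotaD filter_cat size_cat (eq_in_filter (a2 := predT)) ?filter_predT.
  rewrite size_iota (eq_in_filter (a2 := pred0)) ?filter_pred0 ?addn0 // => x.
  by rewrite mem_iota /=; lia.
by move=> x; rewrite mem_iota /=; lia.
Qed.

Lemma std_oneline n (s : 'S_n) : std (oneline s) = oneline s.
Proof. exact: std_perm_iota (oneline_perm s). Qed.

(* The identity is a junk value, used when [std s] is not a permutation of
   size [n]. *)
Definition perm_of n (s : seq nat) : 'S_n :=
  odflt 1%g [pick p : 'S_n | oneline p == std s].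

Lemma perm_ofK n s : uniq s -> size s = n -> oneline (perm_of n s) = std s.
Proof.
move=> us sz; rewrite /perm_of; case: pickP => [p /eqP //|/= no_p].
have lt i : i < n -> nth 0 (std s) i < n by rewrite -sz; apply: std_bound.
pose f (i : 'I_n) := Ordinal (lt _ (ltn_ord i)).
have f_inj : injective f.
  move=> i j /(congr1 val) /= /eqP; rewrite nth_uniq ?std_uniq ?size_std ?sz //.
  by move/eqP/val_inj.
have /eqP[] := no_p (perm f_inj).
apply: (@eq_from_nth _ 0); rewrite size_oneline ?size_std ?sz // => i li.
by rewrite -[i]/(val (Ordinal li)) nth_oneline permE.
Qed.

Lemma perm_of_std n s t : std s = std t -> perm_of n s = perm_of n t.
Proof. by rewrite /perm_of => ->. Qed.

Lemma perm_of_oneline n (p : 'S_n) s : std s = oneline p -> perm_of n s = p.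
Proof.
move=> eq_sp; rewrite /perm_of eq_sp.
by case: pickP => [q /eqP/oneline_inj //|/(_ p)]; rewrite eqxx.
Qed.

(** The letters below [r] never increase. With [r] the letter in front, this forbids a 312 starting
    there; with [r] the next input of a stack machine, it is the order in which the stack must
    empty. *)
Definition dec_below r : seq nat -> bool := pairwise (fun a b => ~~ (a < b < r)).
Fixpoint av312b s := if s is c :: t then dec_below c t && av312b t else true.

Lemma av312P s : reflect (av312 s) (av312b s).
Proof.
apply: (iffP idP); elim: s => //= c s IHs.
  move=> /andP[/(pairwiseP 0) dec /IHs av] [|i] [|j] [|l] //= lij ljl lls.
    move=> h1 h2; have := dec j l; rewrite !inE h1 h2 /=.
    by move=> nlt; apply: notF; apply: nlt => //; lia.
  exact: av.
move=> av; apply/andP; split.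
  apply/(pairwiseP 0) => j l lj ll ljl; apply/negP => /andP[h1 h2].
  by apply: (av 0 j.+1 l.+1).
by apply: IHs => i j l lij ljl lls; apply: (av i.+1 j.+1 l.+1).
Qed.

Lemma av312b_subseq (s t : seq nat) : subseq s t -> av312b t -> av312b s.
Proof.
elim: t s => [|c t IHt] [|d s] //=; case: eqP => [->|_] sub /andP[dec av].
  by rewrite (IHt _ sub av) andbT; apply: subseq_pairwise dec.
exact: (IHt (d :: s)).
Qed.

Lemma avoids312P n (s : 'S_n) : avoids312 s <-> av312 (oneline s).
Proof.
split=> [avs i j l lij ljl lls h1 h2|/av312P avs [m std_m]]; last first.
  have := av312b_subseq (mask_subseq m (oneline s)) avs.
  move: (mask m _) std_m => [|c [|a [|b [|]]]] //= [].
  by rewrite !ltnn /=; case: ltngtP; case: ltngtP; case: ltngtP => //=; lia.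
apply: avs.
(* Three increasing positions form a subsequence of all positions; mapping them to letters yields
   the mask that [contains] asks for. *)
have sub : subseq [:: i; j; l] (iota 0 (size (oneline s))).
  set u := iota _ _.
  have <- : [seq x <- u | x \in [:: i; j; l]] = [:: i; j; l].
    apply: (irr_sorted_eq ltn_trans ltnn).
    - by apply: sorted_filter (iota_ltn_sorted _ _); apply: ltn_trans.
    - by rewrite /= lij ljl.
    - by move=> x; rewrite mem_filter mem_iota !inE; lia.
  exact: filter_subseq.
have := map_subseq (nth 0 (oneline s)) sub; rewrite -/(mkseq _ _) mkseq_nth.
case/subseqP=> m _ eqm; exists m; rewrite -eqm /std /= !ltnn.
have lji := ltn_trans h1 h2.
rewrite lji h1 h2 (ltnNge (nth 0 _ i)) (ltnW lji) (ltnNge (nth 0 _ i)) (ltnW h2).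
by rewrite (ltnNge (nth 0 _ l)) (ltnW h1).
Qed.

(** * Stack words and Catalan numbers *)

(* Outputs of a stack machine that still has to read the inputs
   [r, r+1, ..., r+q-1] and currently holds [st], top first: either the next
   input is pushed or the top is popped.  The outputs are exactly the
   312-avoiding words. *)
Fixpoint stack_outputs q : nat -> seq nat -> seq (seq nat) :=
  if q is q'.+1 then
    fix pop r st := stack_outputs q' r.+1 (r :: st) ++
      (if st is t :: st' then [seq t :: o | o <- pop r st'] else [::])
  else fun _ st => [:: st].

Lemma stack_outputsS q r st : stack_outputs q.+1 r st =
  stack_outputs q r.+1 (r :: st) ++
  (if st is t :: st' then [seq t :: o | o <- stack_outputs q.+1 r st'] else [::]).
Proof. by case: st. Qed.

Arguments stack_outputs : simpl never.

Lemma gtn_trans : transitive gtn.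
Proof. by move=> y x z /= yx zy; apply: ltn_trans zy yx. Qed.

Lemma dec_below_sorted r s : uniq s -> all (gtn r) s ->
  dec_below r s = sorted gtn s.
Proof.
rewrite (sorted_pairwise gtn_trans) /dec_below.
elim: s => //= c s IHs /andP[cs us] /andP[lc ls]; rewrite IHs //; congr (_ && _).
apply: eq_in_all => x xs; have lx : x < r := allP ls x xs.
rewrite lx andbT -leqNgt leq_eqVlt (_ : x == c = false) //.
by apply: contraNF cs => /eqP <-.
Qed.

Lemma dec_below0 s : dec_below 0 s.
Proof.
by rewrite /dec_below; elim: s => //= a s ->; rewrite andbT; apply/allP => b; lia.
Qed.

Lemma av312b_sorted s : sorted gtn s -> av312b s.
Proof.
rewrite (sorted_pairwise gtn_trans); elim: s => //= c s IHs /andP[_ ps].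
rewrite IHs // andbT; apply: sub_pairwise ps => x y /=; lia.
Qed.

Lemma dec_below_succ r s : r \notin s -> dec_below r s -> dec_below r.+1 s.
Proof.
rewrite /dec_below; elim: s => //= c s IHs.
rewrite inE negb_or => /andP[rc rs] /andP[dec ds]; rewrite IHs // andbT.
apply/allP => b bs; have := allP dec _ bs; have : b != r.
  by apply: contraNneq rs => <-.
by move=> /=; lia.
Qed.

(** If [f > r], avoidance makes the letters below [f] decrease after it; if [f = r], the letter [r]
    does not occur again. Either way [r] can be pushed before [f] is output. *)
Lemma dec_below_push r f s : uniq (f :: s) -> r <= f -> dec_below r (f :: s) ->
  av312b (f :: s) -> dec_below r.+1 (f :: s).
Proof.
rewrite /= => /andP[fs _] le_rf /andP[_ dec] /andP[decf _].
apply/andP; split; first by apply/allP => b _; lia.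
move: le_rf; rewrite leq_eqVlt => /predU1P[eq_rf|lt_rf].
  by apply: dec_below_succ; rewrite // eq_rf.
by apply: sub_pairwise decf => a b; lia.
Qed.

Lemma push_sorted r st : sorted gtn st -> all (gtn r) st ->
  sorted gtn (r :: st) /\ all (gtn r.+1) (r :: st).
Proof.
move=> st_sorted st_lt; rewrite /= (path_min_sorted st_lt); split=> //.
by rewrite ltnSn; apply: sub_all st_lt => x /=; lia.
Qed.

(** The stack holds letters below [r], which can only leave in decreasing order; this is the
    condition [dec_below r]. The induction looks at the first letter of the output: at least [r]
    means that [r] is pushed next, smaller means that the top is popped. *)
Lemma mem_stack_outputs q r st o : sorted gtn st -> all (gtn r) st ->
  (o \in stack_outputs q r st) =
  [&& perm_eq o (st ++ iota r q), dec_below r o & av312b o].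
Proof.
elim: q r st o => [|q IHq] r st o.
  move=> st_sorted st_lt /=; rewrite cats0 inE.
  have ust : uniq st := sorted_uniq gtn_trans (fun x => ltnn x) st_sorted.
  apply/eqP/and3P => [->|[eq_o dec _]].
    by rewrite perm_refl dec_below_sorted // av312b_sorted.
  apply: (irr_sorted_eq gtn_trans) => //; first by move=> x /=; rewrite ltnn.
    by rewrite -(@dec_below_sorted r) // ?(perm_uniq eq_o) // (perm_all _ eq_o).
  exact: perm_mem.
have pushE st1 : perm_eq (r :: st1 ++ iota r.+1 q) (st1 ++ iota r q.+1).
  by apply/permPl; apply: (perm_catCA [:: r]).
elim: st o => [|t st IHst] o st_sorted st_lt;
  have [psorted plt] := push_sorted st_sorted st_lt;
  rewrite stack_outputsS mem_cat IHq //=.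
- rewrite in_nil orbF; apply/and3P/and3P => -[eq_o dec av]; split => //.
    by apply: sub_pairwise dec => a b; lia.
  case: o eq_o dec av => // f o eq_o dec av; apply: dec_below_push => //.
    by rewrite (perm_uniq eq_o) (iota_uniq r q.+1).
  have : f \in iota r q.+1 by rewrite -(perm_mem eq_o) mem_head.
  by rewrite mem_iota => /andP[].
- rewrite (permPr (pushE (t :: st))).
  have lt_tr : t < r by case/andP: st_lt.
  have lt_st : all (gtn r) st by case/andP: st_lt.
  have lt_st_t x : x \in st -> x < t.
    by apply: (allP (order_path_min gtn_trans st_sorted)).
  have st'_sorted := path_sorted st_sorted.
  have u_all : uniq ((t :: st) ++ iota r q.+1).
    rewrite cat_uniq iota_uniq (sorted_uniq gtn_trans (fun x => ltnn x)) //.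
    apply/and3P; split=> //; apply/hasPn => x; rewrite mem_iota => /andP[le_rx _].
    by apply/negP => xst; have := allP st_lt _ xst; rewrite /= ltnNge le_rx.
  apply/orP/and3P => [[/and3P[eq_o dec av]|/mapP[w ww ->]]|[eq_o dec av]].
  + by split => //; apply: sub_pairwise dec => a b; lia.
  + move: ww; rewrite IHst // => /and3P[eq_w dec av]; split.
    * by rewrite perm_cons.
    * rewrite /= dec andbT; apply/allP => b; rewrite (perm_mem eq_w) mem_cat.
      by rewrite mem_iota => /orP[/lt_st_t|]; lia.
    * by rewrite /= av andbT; apply: sub_pairwise dec => a b; lia.
  + case: o eq_o dec av => [/perm_size //|f w eq_o dec av].
    have [le_rf|lt_fr] := leqP r f.
      left; rewrite eq_o av andbT /=; apply: dec_below_push => //.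
      by rewrite (perm_uniq eq_o).
    right; have : f \in (t :: st) ++ iota r q.+1.
      by rewrite -(perm_mem eq_o) mem_head.
    rewrite mem_cat mem_iota orbC ltnNge in lt_fr *; rewrite (negbTE lt_fr) /= inE.
    case: eqP => [eq_ft _|/eqP ne_ft /= /lt_st_t lt_ft].
      rewrite eq_ft in eq_o dec av *; apply: map_f; rewrite IHst //.
      by move: eq_o dec av; rewrite /= perm_cons => -> /andP[_ ->] /andP[_ ->].
    (* Here [f] lies below the top [t], which comes later, so [f], [t] is an increase below [r]. *)
    have : t \in f :: w by rewrite (perm_mem eq_o) mem_head.
    rewrite inE eq_sym (negbTE ne_ft) /= => tw.
    by case/andP: dec => /allP/(_ _ tw); rewrite lt_ft lt_tr.
Qed.

(** * Ballot numbers and the Catalan count *)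

(** The binomial coefficient with lower index [q - 1], equal to 0 at [q = 0], where truncated
    subtraction would give 1. *)
Definition bin_pred n q := if q is q'.+1 then 'C(n, q') else 0.

Lemma binSp n q : 'C(n.+1, q) = 'C(n, q) + bin_pred n q.
Proof. by case: q => [|q]; rewrite ?bin0 // binS. Qed.

(** The ballot number, as a difference of two neighbouring binomials, in additive form. Push and pop
    match Pascal's rule on both binomials; for the empty stack the absent pop term is settled by the
    symmetry of the row [2q + 1]. *)
Lemma size_stack_outputs q r st :
  size (stack_outputs q r st) + bin_pred (q.*2 + size st) q = 'C(q.*2 + size st, q).
Proof.
elim: q r st => [|q IHq] r st; first by rewrite bin0.
have IHr := IHq r.+1 (r :: st); move: IHr; rewrite [bin_pred _ q.+1]/= !doubleS.
elim: st => [|t st IHst]; rewrite stack_outputsS size_cat /= ?size_map.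
  rewrite !addn0 addn1 => IHr; rewrite binS (binSp _ q).
  have : 'C(q.*2.+1, q.+1) = 'C(q.*2.+1, q).
    by rewrite -bin_sub; [congr 'C(_, _); lia | lia].
  by lia.
have := IHst (IHq r.+1 (r :: st)).
rewrite !addSn !addnS; set N := (q.*2 + _).+2 => IH2 IHr.
by rewrite binS (binSp _ q); lia.
Qed.

(** For [n = q + 1], the identity [n 'C(2n, n) = (n + 1) 'C(2n, n - 1)] turns the ballot difference
    into an exact quotient by [n + 1]. *)
Lemma size_stack_outputs0 n : size (stack_outputs n 0 [::]) = catalan n.
Proof.
have := size_stack_outputs n 0 [::]; rewrite addn0 /catalan; case: n => // q.
rewrite [bin_pred _ _]/=; have := mul_bin_left (q.+1).*2 q.
rewrite (_ : _ - q = q.+2); last by lia.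
move: (size _) 'C(_, q) 'C(_, q.+1) => S a b h1 h2.
by rewrite (_ : b = S * q.+2) ?mulnK //; nia.
Qed.

(** Once [r] is pushed above the top [t], it leaves before [t]; so no output arises both from a push
    and from a pop. *)
Lemma uniq_stack_outputs q r st : sorted gtn st -> all (gtn r) st ->
  uniq (stack_outputs q r st).
Proof.
elim: q r st => [|q IHq] // r; elim=> [|t st IHst] st_sorted st_lt;
  have [psorted plt] := push_sorted st_sorted st_lt.
  by rewrite stack_outputsS cats0 IHq.
have lt_tr : t < r by case/andP: st_lt.
have lt_st : all (gtn r) st by case/andP: st_lt.
rewrite stack_outputsS cat_uniq IHq // map_inj_uniq; last by move=> x y [].
rewrite IHst ?(path_sorted st_sorted) // andbT.
apply/hasPn => _ /mapP[w _ ->]; rewrite mem_stack_outputs //.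
apply/negP => /and3P[eq_w /andP[/allP/(_ r) dec _] _].
have : r \in t :: w by rewrite (perm_mem eq_w) mem_head.
by rewrite inE gtn_eqF //= => /dec; lia.
Qed.

Lemma card_av312 n : #|[pred p : 'S_n | av312b (oneline p)]| = catalan n.
Proof.
rewrite -size_stack_outputs0 cardE -(size_map (@oneline n)).
apply/perm_size/uniq_perm.
- by rewrite (map_inj_uniq (@oneline_inj n)) enum_uniq.
- exact: uniq_stack_outputs.
move=> o; rewrite mem_stack_outputs //= dec_below0.
apply/mapP/andP => [[p]|[eq_o avo]].
  by rewrite mem_enum => avp ->; rewrite oneline_perm.
have uo : uniq o by rewrite (perm_uniq eq_o) iota_uniq.
have op : oneline (perm_of n o) = o.
  rewrite perm_ofK ?(std_perm_iota eq_o) //.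
  by rewrite (perm_size eq_o) size_iota.
by exists (perm_of n o); rewrite // mem_enum inE op.
Qed.

(** * Walks of the overlap graph *)

Definition window k i (s : seq nat) := take k (drop i s).

(** Subtraction is truncated: a word shorter than [k] has the empty walk. *)
Definition walk k (s : seq nat) : seq 'S_k :=
  [seq perm_of k (window k i s) | i <- iota 0 ((size s).+1 - k)].

Lemma size_walk k s : size (walk k s) = (size s).+1 - k.
Proof. by rewrite size_map size_iota. Qed.

Lemma nth_walk k s e i : i < (size s).+1 - k ->
  nth e (walk k s) i = perm_of k (window k i s).
Proof. by move=> li; rewrite (nth_map 0) ?size_iota // nth_iota. Qed.

Lemma size_window k i s : i < (size s).+1 - k -> size (window k i s) = k.
Proof. by move=> li; rewrite size_takel // size_drop; lia. Qed.

Lemma window_uniq k i (s : seq nat) : uniq s -> uniq (window k i s).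
Proof. by move=> us; rewrite take_uniq // drop_uniq. Qed.

Lemma window_std k i s t : std s = std t ->
  std (window k i s) = std (window k i t).
Proof. by move=> eq_st; apply/std_take/std_drop. Qed.

Lemma av312_window k i s : av312 s -> av312 (window k i s).
Proof. by move=> avs; apply/av312_take/av312_drop. Qed.

Lemma oneline_window k i s : uniq s -> i < (size s).+1 - k ->
  oneline (perm_of k (window k i s)) = std (window k i s).
Proof. by move=> us li; rewrite perm_ofK ?window_uniq ?size_window. Qed.

Lemma walk_std k s t : std s = std t -> walk k s = walk k t.
Proof.
move=> eq_st; rewrite /walk; have [-> _] := (std_eqP s t).1 eq_st.
by apply: eq_map => i; apply: perm_of_std; apply: window_std.
Qed.

Lemma cocc_walk k n (p : 'S_k) (s : 'S_n) :
  cocc p s = count_mem p (walk k (oneline s)).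
Proof.
rewrite /cocc count_map size_oneline; apply: eq_in_count => i.
rewrite mem_iota add0n => /= li; rewrite -(inj_eq (@oneline_inj k)).
by rewrite oneline_window ?oneline_uniq ?size_oneline.
Qed.

Definition avoiding k : pred 'S_k := fun e => av312b (oneline e).
Arguments avoiding k : clear implicits.

Lemma avoidingP k (e : 'S_k) : avoiding k e <-> avoids312 e.
Proof.
by rewrite avoids312P; split => /av312P.
Qed.

Lemma walk_avoiding k s : uniq s -> av312 s -> all (avoiding k) (walk k s).
Proof.
move=> us avs; apply/allP => _ /mapP[i + ->]; rewrite mem_iota add0n => /= li.
rewrite /avoiding oneline_window //; apply/av312P/av312_std.
exact: av312_window.
Qed.

Lemma ovsrc_window k i s : uniq s -> i < (size s).+1 - k ->
  ovsrc (perm_of k (window k i s)) = std (window k.-1 i s).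
Proof.
move=> us li; rewrite /ovsrc oneline_window // (std_take _ (std_idem _)).
by rewrite take_takel // leq_pred.
Qed.

Lemma ovtgt_window k i s : 0 < k -> uniq s -> i < (size s).+1 - k ->
  ovtgt (perm_of k (window k i s)) = std (window k.-1 i.+1 s).
Proof.
move=> k_gt0 us li; rewrite /ovtgt oneline_window // (std_drop _ (std_idem _)).
congr std; rewrite /window -[in LHS](prednK k_gt0) -[k.-1.+1]addn1 -take_drop drop_drop.
by rewrite add1n.
Qed.

Lemma walk_src k s : uniq s ->
  map (@ovsrc k) (walk k s) =
  [seq std (window k.-1 i s) | i <- iota 0 ((size s).+1 - k)].
Proof.
move=> us; rewrite -map_comp; apply/eq_in_map => i.
by rewrite mem_iota add0n => /= li; rewrite ovsrc_window.
Qed.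

(** Targets run through the same windows of size [k - 1] as sources, one position later. *)
Lemma walk_tgt k s : 0 < k -> uniq s ->
  map (@ovtgt k) (walk k s) =
  [seq std (window k.-1 i s) | i <- iota 1 ((size s).+1 - k)].
Proof.
move=> k_gt0 us; have -> n : iota 1 n = map succn (iota 0 n) by rewrite -(iotaDl 1 0).
rewrite -!map_comp; apply/eq_in_map => i.
by rewrite mem_iota add0n => /= li; rewrite ovtgt_window.
Qed.

Lemma walk_sorted k s : 0 < k -> uniq s -> sorted (@ovrel k) (walk k s).
Proof.
move=> k_gt0 us; apply/(sortedP (perm_of k s)) => i; rewrite size_walk => li.
rewrite !nth_walk ?(ltnW li) // /ovrel ovtgt_window ?ovsrc_window //.
exact: ltnW.
Qed.

(** * Appending a letter to a word *)

(** [bump w] lifts the letters that are at least [w] by one, which frees the value [w] for a new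
    letter. *)
Lemma ltn_bump w a b : (bump w a < bump w b) = (a < b).
Proof. by rewrite /bump; case: (leqP w a); case: (leqP w b); lia. Qed.

Lemma bump_lt w a : (bump w a < w) = (a < w).
Proof. by rewrite /bump; case: (leqP w a); lia. Qed.

Lemma lt_bump w a : (w < bump w a) = (w <= a).
Proof. by rewrite /bump; case: (leqP w a); lia. Qed.

(** [w] is the smallest letter of the last window that must exceed the new one. A 312 ending in the
    new letter would already give a 312 in [s] or in [e], according to whether its middle letter
    precedes or follows that smallest letter. *)
Lemma insert_value k (s : seq nat) (e : 'S_k.+1) :
  uniq s -> av312 s -> k <= size s -> avoiding k.+1 e ->
  std (drop (size s - k) s) = ovsrc e ->
  exists w,
    (forall j, j < k ->
       (nth 0 s (size s - k + j) < w) = (nth 0 (oneline e) j < nth 0 (oneline e) k)) /\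
    (forall i j, i < j -> j < size s -> nth 0 s j < w -> w <= nth 0 s i -> False).
Proof.
move=> us avs le_ks /av312P avo eq_src.
set o := oneline e in avo *; set p := size s - k.
have szo : size o = k.+1 by rewrite size_oneline.
have same i j : i < k -> j < k ->
    (nth 0 s (p + i) < nth 0 s (p + j)) = (nth 0 o i < nth 0 o j).
  have [_ eq_lt] := (std_eqP (drop p s) (take k o)).1 eq_src.
  move=> li lj; have := eq_lt i j; rewrite size_drop !nth_drop !nth_take //.
  by apply; rewrite /p; lia.
(* If no letter of the window has to exceed the new one, a value above all of [s] serves. *)
have [[j0 j0P]|no_j] := pselect (exists j : 'I_k, nth 0 o k < nth 0 o j); last first.
  exists (\max_(x <- s) x.+1).
  have lt_max j : j < size s -> nth 0 s j < \max_(x <- s) x.+1.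
    move=> lj; exact: (@leq_bigmax_seq _ s xpredT (fun x => x.+1) _ (mem_nth 0 lj)).
  split=> [j lj|i j lij lj _]; last by rewrite leqNgt lt_max // (ltn_trans lij).
  rewrite lt_max; last by rewrite /p; lia.
  apply/esym; rewrite ltnNge leq_eqVlt negb_or; apply/andP; split.
    by rewrite nth_uniq ?oneline_uniq ?szo //; lia.
  by apply/negP => lt_j; apply: no_j; exists (Ordinal lj).
case: (@arg_minnP _ j0 (fun j : 'I_k => nth 0 o k < nth 0 o j)
  (fun j => nth 0 o j) j0P) => j1 lt_j1 min_j1.
have lj1 := ltn_ord j1.
(* By minimality of [j1], no letter of the window lies strictly between the new letter and the one
   at [j1]. *)
have below j : j < k -> (nth 0 o j < nth 0 o j1) = (nth 0 o j < nth 0 o k).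
  move=> lj; apply/idP/idP => [lt_j|/ltn_trans]; last by apply.
  have : ~~ (nth 0 o k < nth 0 o j).
    by apply/negP => /(min_j1 (Ordinal lj)); rewrite leqNgt lt_j.
  rewrite -leqNgt leq_eqVlt => /predU1P[/eqP|//].
  by rewrite nth_uniq ?oneline_uniq ?szo //; lia.
exists (nth 0 s (p + j1)); split=> [j lj|i j lij lj lt_j le_i].
  by rewrite same // below.
have [lt_jp|lt_pj|eq_j] := ltngtP j (p + j1).
(* The letter of value [w] can replace the new one as the 2 of the pattern, inside [s]. *)
- apply: (avs i j (p + j1)) => //; first by rewrite /p; lia.
  move: le_i; rewrite leq_eqVlt => /predU1P[/eqP|//].
  have lp : p + j1 < size s by rewrite /p; lia.
  by rewrite nth_uniq ?(ltn_trans lij) // gtn_eqF // (ltn_trans lij).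
(* Now the middle letter lies in the window, and [j1], [j'], [k] is a 312 of [e]. *)
- have [j' lj' eq_j] : exists2 j', j' < k & j = p + j'.
    by exists (j - p); rewrite /p in lt_pj *; lia.
  rewrite eq_j same // below // in lt_j.
  by apply: (avo j1 j' k) => //; rewrite ?szo //; lia.
- by rewrite eq_j ltnn in lt_j.
Qed.

(** Any edge leaving the current vertex can be followed at the cost of one letter: bumping keeps all
    old patterns, and only one window contains the new letter. *)
Lemma extend_walk k (s : seq nat) (e : 'S_k.+1) :
  uniq s -> av312 s -> k <= size s -> avoiding k.+1 e ->
  std (drop (size s - k) s) = ovsrc e ->
  exists t, [/\ uniq t, av312 t, size t = (size s).+1 &
    walk k.+1 t = rcons (walk k.+1 s) e].
Proof.
move=> us avs le_ks ave eq_src.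
have [w [w_last w_av]] := insert_value us avs le_ks ave eq_src.
pose s' := map (bump w) s; pose t := rcons s' w.
have szs' : size s' = size s by rewrite size_map.
have szt : size t = (size s).+1 by rewrite size_rcons szs'.
have eq_s' : std s' = std s by apply: std_map => x y; rewrite ltn_bump.
have last_t : std (drop (size s - k) t) = oneline e.
  have -> : drop (size s - k) t = rcons (drop (size s - k) s') w.
    by rewrite -drop_rcons // szs' leq_subr.
  have szo := size_oneline e.
  have oE : oneline e = rcons (take k (oneline e)) (nth 0 (oneline e) k).
    by rewrite -take_nth ?szo // take_oversize // szo.
  rewrite -[RHS]std_oneline [in RHS]oE; apply: std_rcons.
    by rewrite (std_drop _ eq_s') eq_src.
  move=> j; rewrite size_drop szs' => lj; have lj' : j < k by lia.
  rewrite nth_drop nth_take // (nth_map 0); last by lia.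
  rewrite bump_lt lt_bump (leqNgt w) w_last //; split=> //.
  rewrite -leqNgt leq_eqVlt nth_uniq ?szo ?oneline_uniq //; lia.
exists t; split=> //.
- rewrite rcons_uniq map_inj_uniq; last first.
    move=> x y eq_xy; have := ltn_bump w x y; have := ltn_bump w y x.
    by rewrite eq_xy ltnn; case: ltngtP.
  rewrite us andbT; apply/negP => /mapP[x _ eq_w].
  by have := neq_bump w x; rewrite -eq_w eqxx.
- move=> i j l lij ljl; rewrite szt ltnS leq_eqVlt !nth_rcons szs'.
  move=> /predU1P[eq_l|ll].
    have lj : j < size s by rewrite -eq_l.
    have li := ltn_trans lij lj.
    rewrite eq_l ltnn eqxx lj li !(nth_map 0) // bump_lt lt_bump.
    exact: w_av.
  have lj := ltn_trans ljl ll; have li := ltn_trans lij lj.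
  by rewrite ll lj li !(nth_map 0) // !ltn_bump; apply: avs.
- rewrite /walk szt !subSS subSn // -[(_ - _).+1]addn1 iotaD map_cat -cats1 add0n.
  congr (_ ++ _); last first.
    congr [:: _]; apply: perm_of_oneline; rewrite /window take_oversize //.
    by rewrite size_drop szt; lia.
  apply/eq_in_map => i; rewrite mem_iota add0n => /= li; apply: perm_of_std.
  rewrite -(window_std _ _ eq_s') /window drop_rcons ?szs'; last by lia.
  by rewrite -cats1 takel_cat // size_drop szs'; lia.
Qed.

(** The first edge is its own word; the remaining edges are appended one at a time, the last window
    of size [k] being the vertex reached so far. *)
Lemma lift_walk k (e : 'S_k.+1) c : all (avoiding k.+1) (e :: c) ->
  path (@ovrel k.+1) e c ->
  exists s, [/\ uniq s, av312 s, size s = k.+1 + size c & walk k.+1 s = e :: c].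
Proof.
elim/last_ind: c => [|c f IHc].
  rewrite /= andbT => /av312P ave _; exists (oneline e).
  rewrite oneline_uniq size_oneline addn0; split=> //.
  rewrite /walk size_oneline subSn // subnn /= /window drop0 take_oversize.
    by rewrite (perm_of_oneline (std_oneline e)).
  by rewrite size_oneline.
rewrite -rcons_cons all_rcons rcons_path => /andP[avf /IHc{}IHc] /andP[/IHc]{IHc}.
move=> [s [us avs szs ws]] /eqP tgt_f.
have lt_i : size c < (size s).+1 - k.+1 by rewrite szs; lia.
have [] := extend_walk us avs _ avf; first by rewrite szs; lia.
  rewrite -tgt_f (last_nth e) -ws nth_walk // ovtgt_window //.
  rewrite /window take_oversize; last by rewrite size_drop szs; lia.
  by congr (std (drop _ s)); rewrite szs; lia.
move=> t [ut avt szt wt]; exists t; split=> //.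
  by rewrite szt szs size_rcons; lia.
by rewrite wt ws rcons_cons.
Qed.

Import Order.TTheory GRing.Theory Num.Theory numFieldNormedType.Exports.
Local Open Scope ring_scope.

(** * Unit flows on a directed multigraph *)

Section UnitFlow.
Variables (R : realType) (E : finType) (V : eqType) (src tgt : E -> V).
Variable A : pred E.
Implicit Types (c : seq E) (u : V) (v w : {ffun E -> R}).

Definition conserved w : Prop :=
  forall u, \sum_(e | src e == u) w e = \sum_(e | tgt e == u) w e.

Definition unit_flow w : Prop :=
  [/\ forall e, 0 <= w e, forall e, ~~ A e -> w e = 0, conserved w &
      \sum_e w e = 1].

Definition adj : rel E := fun a b => tgt a == src b.

Definition closed_walk c := [/\ c <> [::], all A c & path.cycle adj c].

Definition freq c : {ffun E -> R} :=
  [ffun e => (count_mem e c)%:R / (size c)%:R].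

Lemma adj_path e c : path adj e c -> map tgt (belast e c) = map src c.
Proof. by elim: c e => //= f c IHc e /andP[/eqP -> /IHc ->]. Qed.

(** Along a closed walk the targets are the sources rotated by one step. *)
Lemma closed_walk_perm c : path.cycle adj c ->
  perm_eq (map src c) (map tgt c).
Proof.
case: c => // e c cyc_c.
have /= := adj_path cyc_c; rewrite belast_rcons map_rcons => /= ->.
by rewrite perm_sym perm_rcons.
Qed.

Lemma closed_walk_count c u : path.cycle adj c ->
  count (fun e => src e == u) c = count (fun e => tgt e == u) c.
Proof.
move=> /closed_walk_perm /seq.permP eq_st.
have countE f : count (fun e => f e == u) c = count_mem u (map f c).
  by rewrite count_map.
by rewrite (countE src) (countE tgt) eq_st.
Qed.

Lemma sum_count_mem (P : pred E) c :
  \sum_(e | P e) (count_mem e c)%:R = (count P c)%:R :> R.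
Proof.
elim: c => [|x c IHc] /=; first by rewrite big1.
under eq_bigr do rewrite natrD.
rewrite big_split IHc natrD; congr (_ + _) => /=.
rewrite (bigID (pred1 x)) /= [X in _ + X]big1 ?addr0; last first.
  by move=> e /andP[_]; rewrite eq_sym => /negbTE ->.
case Px: (P x).
  rewrite (big_pred1 x) ?eqxx // => e /=; case: eqP => [->|_]; rewrite ?Px //.
  by rewrite andbF.
by rewrite big_pred0 // => e; case: eqP => [->|_]; rewrite ?Px ?andbF.
Qed.

Lemma sum_freq (P : pred E) c :
  \sum_(e | P e) freq c e = (count P c)%:R / (size c)%:R.
Proof.
by under eq_bigr do rewrite ffunE; rewrite -mulr_suml sum_count_mem.
Qed.

Lemma freq_flow c : closed_walk c -> unit_flow (freq c).
Proof.
case=> c_neq0 /allP Ac cyc_c; split=> [e|e nAe|u|].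
- by rewrite ffunE divr_ge0.
- rewrite ffunE (count_memPn _) ?mul0r //.
  by apply: contraNN nAe => /Ac.
- by rewrite !sum_freq closed_walk_count.
- rewrite sum_freq count_predT divff // pnatr_eq0 size_eq0.
  exact/eqP.
Qed.

Lemma sum_scale_ffunE m (l : 'I_m -> R) (p : 'I_m -> {ffun E -> R}) e :
  (\sum_(i < m) l i *: p i) e = \sum_(i < m) l i * p i e.
Proof. by rewrite sum_ffunE; apply: eq_bigr => i _; rewrite ffunE. Qed.

(** Each condition on a unit flow is a linear equation or inequality and survives convex
    combinations. *)
Lemma conv_unit_flow (S : set {ffun E -> R}) (x : {ffun E -> R}) :
  (forall v, S v -> unit_flow v) -> Defs.conv S x -> unit_flow x.
Proof.
move=> flowS [m [p [l [Sp [l_ge0 [sum_l ->]]]]]].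
have flow_p i := flowS _ (Sp i).
have sumE P : \sum_(e | P e) (\sum_(i < m) l i *: p i) e =
    \sum_(i < m) l i * \sum_(e | P e) p i e.
  under eq_bigr do rewrite sum_scale_ffunE.
  by rewrite exchange_big; apply: eq_bigr => i _; rewrite mulr_sumr.
split=> [e|e nAe|u|].
- rewrite sum_scale_ffunE sumr_ge0 // => i _; rewrite mulr_ge0 //.
  by case: (flow_p i).
- rewrite sum_scale_ffunE big1 // => i _.
  by case: (flow_p i) => _ -> //; rewrite mulr0.
- by rewrite !sumE; apply: eq_bigr => i _; case: (flow_p i) => _ _ ->.
- rewrite sumE -[RHS]sum_l; apply: eq_bigr => i _.
  by case: (flow_p i) => _ _ _ ->; rewrite mulr1.
Qed.

(** * Decomposition of flows into simple cycles *)

(** Pigeonhole on [#|E| + 1] iterates. The periodic point is an iterate of [x0], so it inherits what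
    holds along that orbit. *)
Lemma iter_periodic (f : E -> E) x0 :
  exists x n, (0 < n)%N /\ iter n f x = x /\ exists m, x = iter m f x0.
Proof.
pose g (i : 'I_#|E|.+1) := iter i f x0.
have /injectivePn[i [j ne_ij eq_g]] : ~~ injectiveb g.
  apply/negP => /injectiveP/leq_card; rewrite card_ord; lia.
wlog lt_ij : i j ne_ij eq_g / (i < j)%N => [IH|].
  have : (i : nat) != j by [].
  rewrite neq_ltn => /orP[lt_ij|lt_ji]; first exact: (IH i j).
  by apply: (IH j i); rewrite // eq_sym.
exists (g i), (j - i)%N; rewrite subn_gt0 lt_ij -iterD subnK 1?ltnW //.
by split=> //; split=> //; exists i.
Qed.

Definition simple_cycle_in (P : pred E) c := [/\ c <> [::], all P c,
  path.cycle adj c & uniq (map src c)].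

(** Positive edges are followed until the walk becomes periodic. The successor of an edge is chosen
    from its target alone, so two edges of the period with the same source coincide and the cycle is
    simple. *)
Lemma exists_simple_cycle w e0 : (forall e, 0 <= w e) -> conserved w ->
  0 < w e0 -> exists c, simple_cycle_in (fun e => 0 < w e) c.
Proof.
move=> w_ge0 cons_w w_e0.
pose f e := odflt e [pick e' | (src e' == tgt e) && (0 < w e')].
have fP e : 0 < w e -> src (f e) = tgt e /\ 0 < w (f e).
  move=> w_e; rewrite /f; case: pickP => [e' /andP[/eqP ? ?] //|no_e'].
  (* Without a positive edge leaving [tgt e], the outflow there would be 0, but the inflow is at
     least [w e]. *)
  have := cons_w (tgt e); rewrite [LHS]big1 => [|e' /eqP eq_e'].
    rewrite (bigD1 e) //= => /eqP; rewrite lt_eqF // ltr_wpDr // sumr_ge0 //.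
  by apply: le_anti; rewrite w_ge0 leNgt; have := no_e' e'; rewrite eq_e' eqxx /= => ->.
have f_tgt e e' : 0 < w e -> tgt e = tgt e' -> f e = f e'.
  move=> w_e eq_t; rewrite /f -eq_t; case: pickP => //= no_e'.
  have [fs fw] := fP e w_e; have := no_e' (f e).
  by rewrite fs eqxx fw.
have [x [n [n_gt0 [fx [m xE]]]]] := iter_periodic f e0.
have pos_iter k : 0 < w (iter k f e0).
  by elim: k => //= k /fP[].
have pos_orb y : y \in fingraph.orbit f x -> 0 < w y.
  by rewrite -fconnect_orbit => /iter_findex <-; rewrite xE -iterD.
have cyc : fcycle f (fingraph.orbit f x).
  by apply/(orbitPcycle 3 0); exists n.-1; rewrite prednK.
exists (fingraph.orbit f x); split.
- by move=> orb0; have := fingraph.order_gt0 f x; rewrite -size_orbit orb0.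
- by apply/allP => y; apply: pos_orb.
- apply: (sub_in_cycle (P := mem (fingraph.orbit f x))) cyc =>
    [a b /pos_orb wa _|]; last exact/allP.
  by rewrite /adj => /eqP <-; have [-> _] := fP _ wa.
- rewrite map_inj_in_uniq ?orbit_uniq // => a b ain bin.
  have prevP y : y \in fingraph.orbit f x -> exists2 z, 0 < w z & y = f z.
    move=> yin; exists (prev (fingraph.orbit f x) y).
      by apply: pos_orb; rewrite mem_prev.
    by have /eqP := prev_cycle cyc yin.
  have [a' wa' ->] := prevP _ ain; have [b' wb' ->] := prevP _ bin.
  have [-> _] := fP _ wa'; have [-> _] := fP _ wb'.
  exact: f_tgt.
Qed.

Lemma simple_cycle_closed c : simple_cycle_in A c -> closed_walk c.
Proof. by case. Qed.

Lemma flow_of_simple c : simple_cycle_in A c -> unit_flow (freq c).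
Proof. by move/simple_cycle_closed/freq_flow. Qed.

Lemma freq_simple c e : uniq (map src c) -> e \in c ->
  freq c e = (size c)%:R^-1.
Proof. by move=> /map_uniq uc ec; rewrite ffunE count_uniq_mem // ec mul1r. Qed.

Lemma freq_notin c e : e \notin c -> freq c e = 0.
Proof. by move=> ec; rewrite ffunE (count_memPn ec) mul0r. Qed.

(** On [c] the frequency is [1 / size c], so [size c] times the least weight on [c] is the largest
    multiple that fits under [w], and it exhausts an edge of least weight. *)
Lemma remove_cycle w c : (forall e, 0 <= w e) ->
  simple_cycle_in (fun e => 0 < w e) c ->
  exists t, [/\ 0 < t, forall e, t * freq c e <= w e &
    exists2 e, 0 < w e & t * freq c e = w e].
Proof.
move=> w_ge0 [c_neq0 /allP wc cyc_c uc].
have szc : 0 < (size c)%:R :> R by rewrite ltr0n lt0n size_eq0; apply/eqP.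
have [e0 e0c] : exists e0, e0 \in c.
  by case: c {wc cyc_c uc szc} c_neq0 => // e c _; exists e; rewrite mem_head.
have [e ec min_e] : exists2 e, e \in c & forall e', e' \in c -> w e <= w e'.
  by case: (arg_minP (fun e => w e) e0c) => e ec min_e; exists e.
have we := wc _ ec.
exists (w e * (size c)%:R); split.
- exact: mulr_gt0.
- move=> e'; have [e'c|e'c] := boolP (e' \in c).
    by rewrite freq_simple // mulfK ?gt_eqF // min_e.
  by rewrite freq_notin ?mulr0.
- by exists e => //; rewrite freq_simple // mulfK ?gt_eqF.
Qed.

Definition simple_freqs : set {ffun E -> R} :=
  fun x => exists c, simple_cycle_in A c /\ x = freq c.

(** Induction on a bound for the size of the support: removing a simple cycle as far as possible
    loses an edge and adds none. *)
Lemma cone_decomposition n w : (#|[pred e | w e != 0%R]| <= n)%N ->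
  (forall e, 0 <= w e) -> (forall e, ~~ A e -> w e = 0) -> conserved w ->
  exists s : seq (R * {ffun E -> R}),
    (forall x, x \in s -> 0 <= x.1 /\ simple_freqs x.2) /\
    w = \sum_(x <- s) x.1 *: x.2.
Proof.
elim: n w => [|n IHn] w card_w w_ge0 wA cons_w.
  exists [::]; split=> //; rewrite big_nil; apply/ffunP => e; rewrite ffunE.
  apply/eqP; apply: contraTT card_w => we; rewrite -ltnNge.
  by apply/card_gt0P; exists e.
have [[e0 we0]|no_e] := pselect (exists e, w e != 0); last first.
  apply: IHn => //; rewrite eq_card0 // => e; apply/negP => we.
  by apply: no_e; exists e; apply/negP.
have pos_e0 : 0 < w e0 by rewrite lt_def we0 w_ge0.
have [c simple_c] := exists_simple_cycle w_ge0 cons_w pos_e0.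
have simple_cA : simple_cycle_in A c.
  case: simple_c => c0 /allP wc ? ?; split=> //; apply/allP => e /wc we.
  by apply: contraLR we => /wA ->; rewrite ltxx.
have [t [t_gt0 t_le [e1 we1 te1]]] := remove_cycle w_ge0 simple_c.
have [fge0 fA fcons fsum] := flow_of_simple simple_cA.
pose w' := w - t *: freq c.
have w'E e : w' e = w e - t * freq c e by rewrite !ffunE.
have [||||s [sP w'_sum]] := IHn w'.
- rewrite -ltnS; apply: leq_trans card_w; apply: proper_card.
  apply/properP; split.
    apply/fintype.subsetP => e; rewrite !inE w'E; apply: contraNN => /eqP we.
    have := t_le e; have := fge0 e; rewrite we => f_ge0 f_le0.
    rewrite sub0r oppr_eq0; apply/eqP/le_anti; rewrite f_le0 mulr_ge0 //.
    exact: ltW.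
  by exists e1; rewrite !inE ?w'E ?te1 ?subrr ?eqxx // gt_eqF.
- by move=> e; rewrite w'E subr_ge0.
- by move=> e nAe; rewrite w'E wA // fA // mulr0 subrr.
- move=> u; under eq_bigr do rewrite w'E; under [RHS]eq_bigr do rewrite w'E.
  by rewrite !sumrB -!mulr_sumr cons_w fcons.
exists ((t, freq c) :: s); split=> [x|].
  rewrite inE => /predU1P[->|/sP //]; split; first exact: ltW.
  by exists c.
by rewrite big_cons -w'_sum /w' addrC subrK.
Qed.

(** Every simple cycle has total mass 1, so the coefficients of a conic decomposition of a unit flow
    add up to its mass 1. *)
Lemma unit_flow_conv w : unit_flow w <-> Defs.conv simple_freqs w.
Proof.
split=> [[w_ge0 wA cons_w sum_w]|]; last first.
  by apply: conv_unit_flow => v [c [/flow_of_simple fc ->]].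
have [s [sP wE]] := cone_decomposition (leqnn _) w_ge0 wA cons_w.
exists (size s), (fun i => (tnth (in_tuple s) i).2), (fun i => (tnth (in_tuple s) i).1).
have sP' i := sP _ (mem_tnth i (in_tuple s)).
split; first by move=> i; have [] := sP' i.
split; first by move=> i; have [] := sP' i.
have wE' : w = \sum_(i < size s)
    (tnth (in_tuple s) i).1 *: (tnth (in_tuple s) i).2 by rewrite wE big_tnth.
split; last exact: wE'.
rewrite -sum_w wE'.
under [RHS]eq_bigr do rewrite sum_scale_ffunE.
rewrite exchange_big; apply: eq_bigr => i _ /=; rewrite -mulr_sumr.
have [_ [c [/flow_of_simple [_ _ _ sum_c] ->]]] := sP' i.
by rewrite sum_c mulr1.
Qed.

(** * Vertices of the polytope of unit flows *)

(** Conservation makes [v] constant along [c], and the total mass determines the constant. *)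
Lemma unit_flow_on_simple c v : simple_cycle_in A c -> unit_flow v ->
  (forall e, e \notin c -> v e = 0) -> v = freq c.
Proof.
case=> c_neq0 _ cyc_c uc [v_ge0 _ cons_v sum_v] v0.
have uniq_c := map_uniq uc.
(* By simplicity, within [c] only [e] enters and only [f] leaves their common vertex. *)
have adjE e f : e \in c -> f \in c -> adj e f -> v e = v f.
  have ut : uniq (map tgt c) by rewrite -(perm_uniq (closed_walk_perm cyc_c)).
  have only (h : E -> V) a : uniq (map h c) -> a \in c ->
      \sum_(b | h b == h a) v b = v a.
    move=> uh ac; rewrite (bigD1 a) //= big1 ?addr0 // => b /andP[/eqP eq_h ne_ab].
    apply: v0; apply: contraNN ne_ab => bc.
    rewrite -(nth_index a bc) (_ : index b c = index a c) ?nth_index //.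
    apply/eqP; rewrite -(nth_uniq (h a) _ _ uh) ?size_map ?index_mem //.
    by rewrite !(nth_map a) ?index_mem // !nth_index // eq_h.
  move=> ec fc /eqP tgt_e; have := cons_v (tgt e).
  by rewrite [in LHS]tgt_e !only.
have cst e f : e \in c -> f \in c -> v e = v f.
  have eqv_trans : transitive (fun a b => v a == v b).
    by move=> b a d /= /eqP -> /eqP ->.
  have cyc_v : path.cycle (fun a b => v a == v b) c.
    apply: (sub_in_cycle (P := mem c)) cyc_c => [a b ac bc /adjE ->//|].
    exact/allP.
  move=> ec fc; have [i c' rot_c] := rot_to ec.
  have : path (fun a b => v a == v b) e (rcons c' e).
    by move: cyc_v; rewrite -(rot_cycle i) rot_c.
  move=> /(order_path_min eqv_trans)/allP/(_ f).
  by rewrite mem_rcons -rot_c mem_rot fc => /(_ isT)/eqP.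
have szc : (size c)%:R != 0 :> R by rewrite pnatr_eq0 size_eq0; apply/eqP.
apply/ffunP => e; have [ec|ec] := boolP (e \in c); last first.
  by rewrite v0 // freq_notin.
rewrite freq_simple //; apply: (mulIf szc); rewrite mulVf // -[RHS]sum_v.
rewrite [RHS](bigID (mem c)) /= [X in _ = _ + X]big1 // addr0.
rewrite [RHS](eq_bigr (fun=> v e)) => [|f fc]; last exact: cst.
by rewrite sumr_const (card_uniqP uniq_c) mulr_natr.
Qed.

(** A vertex [x] is split as a proper combination of a simple cycle of its support and a second flow
    [z], which forces both to be [x]. Conversely, the two parts of a splitting of [freq c] are
    nonnegative, hence vanish off [c], hence equal [freq c]. *)
Lemma unit_flow_vertex x :
  is_vertex (unit_flow : set {ffun E -> R}) x <-> simple_freqs x.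
Proof.
split=> [[flow_x ext_x]|[c [simple_c ->]]].
  have [x_ge0 xA cons_x sum_x] := flow_x.
  have [e0 we0] : exists e, 0 < x e.
    apply: contrapT => no_e; have sum0 : \sum_e x e = 0; last first.
      by move: sum_x; rewrite sum0 => /esym/eqP; rewrite oner_eq0.
    apply: big1 => e _; apply: le_anti; rewrite x_ge0 andbT leNgt; apply/negP => xe.
    by apply: no_e; exists e.
  have [c simple_c] := exists_simple_cycle x_ge0 cons_x we0.
  have simple_cA : simple_cycle_in A c.
    case: simple_c => c0 /allP wc ? ?; split=> //; apply/allP => e /wc we.
    by apply: contraLR we => /xA ->; rewrite ltxx.
  exists c; split=> //.
  have [t [t_gt0 t_le _]] := remove_cycle x_ge0 simple_c.
  have flow_c := flow_of_simple simple_cA; have [c_ge0 cA cons_c sum_c] := flow_c.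
  have t_le1 : t <= 1.
    by rewrite -sum_x -[leLHS]mulr1 -sum_c mulr_sumr ler_sum.
  (* Halving ensures [q < 1] even for [t = 1], so that the remainder can be divided by [1 - q]. *)
  pose q := t / 2; have q_gt0 : 0 < q by rewrite divr_gt0.
  have q_lt1 : q < 1 by rewrite /q; lra.
  have q_le e : q * freq c e <= x e.
    apply: le_trans (t_le e); rewrite ler_wpM2r // /q; lra.
  have q1 : 1 - q != 0 by rewrite gt_eqF // subr_gt0.
  pose z := (1 - q)^-1 *: (x - q *: freq c).
  have zE e : z e = (1 - q)^-1 * (x e - q * freq c e) by rewrite !ffunE.
  have flow_z : unit_flow z.
    split=> [e|e nAe|u|].
    - by rewrite zE mulr_ge0 ?subr_ge0 // invr_ge0 subr_ge0 ltW.
    - by rewrite zE xA // cA // mulr0 subr0 mulr0.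
    - under eq_bigr do rewrite zE; under [RHS]eq_bigr do rewrite zE.
      by rewrite -!mulr_sumr !sumrB -!mulr_sumr cons_x cons_c.
    - under eq_bigr do rewrite zE.
      by rewrite -!mulr_sumr !sumrB -!mulr_sumr sum_x sum_c mulr1 mulVf.
  have xE : x = q *: freq c + (1 - q) *: z.
    by rewrite /z scalerA divff // scale1r addrC subrK.
  have eq_z : freq c = z by apply: (ext_x _ _ q flow_c flow_z _ xE); rewrite q_gt0.
  by rewrite xE -eq_z -scalerDl addrC subrK scale1r.
split; first exact: flow_of_simple.
move=> y z t flow_y flow_z /andP[t_gt0 t_lt1] eq_c.
have yz0 e : e \notin c -> y e = 0 /\ z e = 0.
  move=> ec; have [y_ge0 _ _ _] := flow_y; have [z_ge0 _ _ _] := flow_z.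
  have y_e := y_ge0 e; have z_e := z_ge0 e.
  have : t * y e + (1 - t) * z e = 0.
    by rewrite -[RHS](freq_notin ec) eq_c !ffunE.
  have t1_gt0 : 0 < 1 - t by rewrite subr_gt0.
  move/eqP; rewrite paddr_eq0 ?mulr_ge0 // ?ltW //.
  by rewrite !mulf_eq0 (gt_eqF t_gt0) (gt_eqF t1_gt0) => /andP[/eqP -> /eqP ->].
have -> : y = freq c by apply: unit_flow_on_simple => // e /yz0[].
by apply: esym; apply: unit_flow_on_simple => // e /yz0[].
Qed.

End UnitFlow.

(** * Dimension of the polytope of unit flows *)

Section Dimension.
Variables (R : realType) (E : finType) (V : eqType) (src tgt : E -> V).
Variables (A : pred E) (vs : seq V) (r : V).
Hypothesis vs_uniq : uniq vs.
Hypothesis src_vs : forall e, A e -> src e \in vs.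
Hypothesis tgt_vs : forall e, A e -> tgt e \in vs.
Hypothesis r_vs : r \in vs.
Hypothesis loop_r : exists2 e, A e & src e = r /\ tgt e = r.
(** Connectedness in dual form: a potential that does not change along any edge is constant. *)
Hypothesis connected : forall phi : V -> R,
  (forall e, A e -> phi (src e) = phi (tgt e)) ->
  forall u, u \in vs -> phi u = phi r.
Variable w0 : {ffun E -> R}.
Hypothesis flow_w0 : unit_flow src tgt A w0.
Hypothesis w0_gt0 : forall e, A e -> 0 < w0 e.

Let n := #|A|.
Let m := size vs.
Let vtx (j : 'I_m) : V := tnth (in_tuple vs) j.
Let edge (i : 'I_n) : E := enum_val i.

(* The incidence matrix, with the column of the root (a redundant constraint)
   replaced by the total mass: its left kernel is the direction of the affine
   span of the unit flows. *)
Let incid : 'M[R]_(n, m) := \matrix_(i, j)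
  if vtx j == r then 1
  else (src (edge i) == vtx j)%:R - (tgt (edge i) == vtx j)%:R.

Let edge_in i : A (edge i).
Proof. exact: enum_valP i. Qed.

Lemma vtx_onto u : u \in vs -> exists j, vtx j = u.
Proof. by move=> /(tnthP (in_tuple vs))[j ->]; exists j. Qed.

Lemma vtx_inj : injective vtx.
Proof. by move=> i j; rewrite /vtx; apply/tuple_uniqP. Qed.

(** The columns are independent: the coefficients [y] of a relation give a potential [phi] vanishing
    at the root. The loop at the root kills the coefficient of the mass column, and connectedness
    then makes [phi] constant, hence zero. *)
Lemma incid_rank : \rank incid = m.
Proof.
rewrite -mxrank_tr; apply/eqP; rewrite -[_ == _]/(row_free _).
apply: inj_row_free => y y0.
have [jr jrE] := vtx_onto r_vs.
(* [y] as a function on vertices, set to 0 at the root and outside [vs]. *)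
pose phi u := \sum_(j | (vtx j == u) && (vtx j != r)) y 0 j.
have phiE j : phi (vtx j) = if j == jr then 0 else y 0 j.
  rewrite /phi; case: eqP => [->|ne_j].
    by rewrite big1 // => i; rewrite jrE; case: eqP.
  rewrite (big_pred1 j) // => i /=; rewrite (inj_eq vtx_inj).
  by case: eqP => //= ->; rewrite -jrE (inj_eq vtx_inj); apply/eqP.
have eqn i : y 0 jr + phi (src (edge i)) - phi (tgt (edge i)) = 0.
  have := congr1 (fun B : 'rV[R]_n => B 0 i) y0; rewrite !mxE => <-.
  rewrite (bigD1 jr) //= !mxE jrE eqxx mulr1 -addrA; congr (_ + _).
  rewrite /phi [in LHS]big_mkcond [X in _ - X]big_mkcond -sumrB /=.
  rewrite [RHS]big_mkcond /=; apply: eq_bigr => j _; rewrite !mxE.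
  rewrite -(inj_eq vtx_inj) jrE; case: (vtx j == r) => /=.
    by rewrite !andbF subrr.
  rewrite !andbT !(eq_sym (vtx j)) mulrBr.
  by do 2!case: eqP => _; rewrite ?mulr1 ?mulr0.
have eqnA e : A e -> y 0 jr + phi (src e) - phi (tgt e) = 0.
  by move=> Ae; have := eqn (enum_rank_in Ae e); rewrite /edge enum_rankK_in.
have y_jr : y 0 jr = 0.
  by have [e Ae [es et]] := loop_r; have := eqnA e Ae; rewrite es et addrK.
have phi_const := connected (phi := phi).
have phi_r : phi r = 0 by rewrite -jrE phiE eqxx.
apply/rowP => j; rewrite [RHS]mxE.
have := phi_const _ (vtx j) (mem_tnth _ _); rewrite phiE phi_r.
case: eqP => [-> //|_]; apply=> e Ae.
by have := eqnA _ Ae; rewrite y_jr add0r => /eqP; rewrite subr_eq0 => /eqP.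
Qed.

Let vec (w : {ffun E -> R}) : 'rV[R]_n := \row_i w (edge i).

Lemma sum_edge (P : pred E) (w : {ffun E -> R}) :
  (forall e, ~~ A e -> w e = 0) ->
  \sum_(e | P e) w e = \sum_(i < n) w (edge i) * (P (edge i))%:R.
Proof.
move=> wA; rewrite (bigID A) /= [X in _ + X]big1 ?addr0; last first.
  by move=> e /andP[_ /wA].
rewrite (eq_bigl (fun e => (e \in A) && P e)); last by move=> e; rewrite andbC.
rewrite big_mkcondr /= big_enum_val /=; apply: eq_bigr => i _.
by case: ifP => _; rewrite ?mulr1 ?mulr0.
Qed.

Lemma vec_incid (w : {ffun E -> R}) u0 (j : 'I_m) :
  (forall e, ~~ A e -> w e = 0) -> u0 = vtx j ->
  (vec w *m incid) 0 j = if u0 == r then \sum_e w e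
    else \sum_(e | src e == u0) w e - \sum_(e | tgt e == u0) w e.
Proof.
move=> wA ->; rewrite mxE; case: eqP => [jr|jr].
  rewrite sum_edge //; apply: eq_bigr => i _.
  by rewrite !mxE jr eqxx.
rewrite !sum_edge // -sumrB; apply: eq_bigr => i _.
by rewrite !mxE; case: eqP => // _; rewrite mulrBr.
Qed.

Lemma diff_in_kernel (v w : {ffun E -> R}) :
  unit_flow src tgt A v -> unit_flow src tgt A w ->
  (vec (v - w) <= kermx incid)%MS.
Proof.
move=> [_ vA cv sv] [_ wA cw sw]; apply/sub_kermxP/rowP => j.
have vwE e : (v - w) e = v e - w e by rewrite !ffunE.
rewrite (vec_incid _ erefl) ?mxE; last first.
  by move=> e nAe; rewrite vwE vA // wA // subr0.
have sumE P : \sum_(e | P e) (v - w) e = \sum_(e | P e) v e - \sum_(e | P e) w e.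
  by under eq_bigr do rewrite vwE; rewrite sumrB.
by rewrite !sumE sv sw cv cw !subrr; case: ifP.
Qed.

(** Balance at the root has no column of its own; it follows from the other vertices, because
    outflows and inflows summed over all vertices both give the total mass. *)
Lemma kernel_conserved (w : {ffun E -> R}) : (forall e, ~~ A e -> w e = 0) ->
  (vec w <= kermx incid)%MS -> \sum_e w e = 0 /\ conserved src tgt w.
Proof.
move=> wA /sub_kermxP w0'.
have inc j := congr1 (fun B : 'rV[R]_m => B 0 j) w0'.
have bal u : u != r -> \sum_(e | src e == u) w e = \sum_(e | tgt e == u) w e.
  move=> ur; have [u_vs|u_vs] := boolP (u \in vs).
    have [j jE] := vtx_onto u_vs.
    have := inc j; rewrite (vec_incid wA (esym jE)) mxE (negbTE ur).
    by move/eqP; rewrite subr_eq0 => /eqP.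
  rewrite !big1 // => e /eqP eu; apply: wA; apply: contraNN u_vs; rewrite -eu.
    exact: tgt_vs.
  exact: src_vs.
split=> [|u].
  have [j jE] := vtx_onto r_vs.
  by have := inc j; rewrite (vec_incid wA (esym jE)) mxE eqxx.
have [->|] := eqVneq u r; last exact: bal.
have sumE (h : E -> V) : (forall e, A e -> h e \in vs) ->
    \sum_e w e = \sum_(i < m) \sum_(e | h e == vtx i) w e.
  move=> h_vs; rewrite (exchange_big_dep predT) //=; apply: eq_bigr => e _.
  have [Ae|/wA we0] := boolP (A e).
    have [j jE] := vtx_onto (h_vs _ Ae).
    by rewrite (big_pred1 j) // => i; rewrite -jE (inj_eq vtx_inj) eq_sym.
  by rewrite we0 big1.
have [jr jrE] := vtx_onto r_vs.
have := sumE _ tgt_vs; rewrite (sumE _ src_vs) (bigD1 jr) //= [RHS](bigD1 jr) //= jrE.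
rewrite (eq_bigr (fun i => \sum_(e | tgt e == vtx i) w e)); first exact: addIr.
by move=> i ne_i; apply: bal; rewrite -jrE (inj_eq vtx_inj).
Qed.

Let ext (x : 'rV[R]_n) : {ffun E -> R} :=
  [ffun e => \sum_i (edge i == e)%:R * x 0 i].

Lemma vec_ext x : vec (ext x) = x.
Proof.
apply/rowP => i; rewrite mxE ffunE (bigD1 i) //= eqxx mul1r big1 ?addr0 // => j.
by rewrite (inj_eq enum_val_inj) => /negbTE ->; rewrite mul0r.
Qed.

Lemma ext_off x e : ~~ A e -> ext x e = 0.
Proof.
move=> nAe; rewrite ffunE big1 // => i _; case: eqP => [ei|_]; last by rewrite mul0r.
by rewrite -ei edge_in in nAe.
Qed.

(** Upper bound: differences of unit flows lie in the kernel, of rank [n - m]. Lower bound: [w0] is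
    positive on [A], so small moves from it along a kernel basis remain unit flows. *)
Lemma affdim_unit_flow :
  affdim (unit_flow src tgt A : set {ffun E -> R}) (n - m).
Proof.
have rank_ker : \rank (kermx incid) = (n - m)%N by rewrite mxrank_ker incid_rank.
split; last first.
  move=> p flow_p indep_p.
  pose D : 'M[R]_((n - m).+1, n) := \matrix_i vec (p (lift ord0 i) - p ord0).
  have D_ker : (D <= kermx incid)%MS.
    by apply/row_subP => i; rewrite rowK; apply: diff_in_kernel.
  have : ~~ row_free D.
    by have := mxrankS D_ker; rewrite rank_ker /row_free neq_ltn ltnS => ->.
  move/negP; apply; apply: inj_row_free => c cD0.
  (* The base point receives the coefficient that makes the sum zero. *)
  pose c' i := if unlift ord0 i is Some j then c 0 j else - \sum_j c 0 j.
  have c'0 : c' ord0 = - \sum_j c 0 j by rewrite /c' unlift_none.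
  have c'S j : c' (lift ord0 j) = c 0 j by rewrite /c' liftK.
  suff c'_eq0 i : c' i = 0 by apply/rowP => j; rewrite -c'S c'_eq0 mxE.
  move: i; apply: indep_p.
    rewrite big_ord_recl c'0 [X in _ + X](eq_bigr (c 0)) ?addNr //.
  apply/ffunP => e; rewrite sum_scale_ffunE ffunE.
  have [Ae|nAe] := boolP (A e); last first.
    by rewrite big1 // => i _; have [_ -> //] := flow_p i; rewrite mulr0.
  have comb : \sum_j c 0 j * (p (lift ord0 j) e - p ord0 e) = 0.
    have := congr1 (fun B : 'rV[R]_n => B 0 (enum_rank_in Ae e)) cD0.
    rewrite !mxE => cD; rewrite -[RHS]cD; apply: eq_bigr => j _.
    by rewrite !mxE /edge enum_rankK_in // !ffunE.
  rewrite big_ord_recl c'0 -[RHS]comb.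
  under [RHS]eq_bigr do rewrite mulrBr.
  rewrite sumrB mulNr mulr_suml addrC; congr (_ - _).
  by apply: eq_bigr => j _; rewrite c'S.
rewrite -rank_ker.
pose w (j : 'I_(\rank (kermx incid))) := ext (row j (row_base (kermx incid))).
have w_ker j : (vec (w j) <= kermx incid)%MS.
  by rewrite vec_ext (submx_trans (row_sub _ _)) ?eq_row_base.
have wA j e : ~~ A e -> w j e = 0 by apply: ext_off.
have w_sum j : \sum_e w j e = 0 by case: (kernel_conserved (wA j) (w_ker j)).
have w_cons j : conserved src tgt (w j).
  by case: (kernel_conserved (wA j) (w_ker j)).
(* Dominates every ratio of a basis flow to [w0]; the leading 1 keeps it positive even if the kernel
   is zero. *)
pose K : R := 1 + \sum_j \sum_(e | A e) `|w j e| / w0 e.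
have term_ge0 j e : A e -> 0 <= `|w j e| / w0 e.
  by move=> Ae; rewrite divr_ge0 // ltW ?w0_gt0.
have K_gt0 : 0 < K.
  by rewrite ltr_wpDr // sumr_ge0 // => j _; rewrite sumr_ge0 // => e /term_ge0.
have K_bound j e : A e -> `|w j e| / w0 e <= K.
  move=> Ae; rewrite /K (bigD1 j) //= (bigD1 e) //= addrCA -!addrA lerDl.
  rewrite !addr_ge0 // ?sumr_ge0 // => [f /andP[/term_ge0]|i _] //.
  by rewrite sumr_ge0 // => f /term_ge0.
have [w0_ge0 w0A w0_cons w0_sum] := flow_w0.
pose q j := w0 + K^-1 *: w j.
have qE j e : q j e = w0 e + K^-1 * w j e by rewrite !ffunE.
have flow_q j : unit_flow src tgt A (q j).
  split=> [e|e nAe|u|].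
  - rewrite qE; have [Ae|nAe] := boolP (A e); last by rewrite wA // mulr0 addr0.
    have := K_bound j e Ae; rewrite ler_pdivrMr ?w0_gt0 // => le_K.
    rewrite -lerBlDr sub0r; apply: le_trans (_ : K^-1 * `|w j e| <= _); last first.
      by rewrite ler_pdivrMl.
    by rewrite -mulrN ler_wpM2l ?invr_ge0 ?(ltW K_gt0) // -normrN ler_norm.
  - by rewrite qE w0A // wA // mulr0 addr0.
  - under eq_bigr do rewrite qE; under [RHS]eq_bigr do rewrite qE.
    by rewrite !big_split -!mulr_sumr /= w0_cons w_cons.
  - under eq_bigr do rewrite qE.
    by rewrite !big_split -!mulr_sumr /= w0_sum w_sum mulr0 addr0.
exists (fun i => if unlift ord0 i is Some j then q j else w0); split.
  by move=> i; case: unliftP => [j|] _ //.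
move=> c sum_c; rewrite big_ord_recl unlift_none => comb_c.
have cS j : c (lift ord0 j) = 0.
  pose c' := \row_j c (lift ord0 j).
  suff c'_eq0 : c' = 0.
    by have := congr1 (fun B : 'rV[R]__ => B 0 j) c'_eq0; rewrite !mxE.
  apply/eqP; rewrite -(mulmx_free_eq0 _ (row_base_free (kermx incid))).
  apply/eqP/rowP => i; rewrite !mxE.
  have w_edge l : w l (edge i) = row_base (kermx incid) l i.
    have := vec_ext (row l (row_base (kermx incid))).
    by move/(congr1 (fun B : 'rV[R]_n => B 0 i)); rewrite !mxE.
  under eq_bigr do rewrite mxE -w_edge.
  have comb_i : c ord0 * w0 (edge i) +
      \sum_l c (lift ord0 l) * q l (edge i) = 0.
    have := congr1 (fun f : {ffun E -> R} => f (edge i)) comb_c.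
    rewrite !ffunE sum_ffunE => comb0; rewrite -[RHS]comb0; congr (_ + _).
    by apply: eq_bigr => l _; rewrite liftK [RHS]ffunE.
  rewrite big_ord_recl in sum_c; move: comb_i.
  (* The coefficients sum to 0, so the [w0] parts cancel and a relation among independent kernel
     rows remains. *)
  rewrite (eq_bigr (fun l => c (lift ord0 l) * w0 (edge i) +
    K^-1 * (c (lift ord0 l) * w l (edge i)))); last first.
    by move=> l _; rewrite qE mulrDr [c _ * (K^-1 * _)]mulrCA.
  rewrite big_split /= -mulr_suml -mulr_sumr addrA -mulrDl sum_c mul0r add0r.
  by move/eqP; rewrite mulf_eq0 invr_eq0 (gt_eqF K_gt0) => /eqP.
move=> i; case: (unliftP ord0 i) => [j|] -> //.
by move: sum_c; rewrite big_ord_recl big1 ?addr0.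
Qed.

End Dimension.

(** * Window frequencies *)

Lemma cvg_quotient (R : realType) (a : nat -> R) (ns : nat -> nat) (b K : R) :
  (forall m, (0 < ns m)%N) ->
  (forall N, exists M, forall m, (M <= m)%N -> (N <= ns m)%N) ->
  (forall m, `|a m - b * (ns m)%:R| <= K) ->
  ((fun m => a m / (ns m)%:R) @ \oo --> b)%classic.
Proof.
move=> ns_gt0 ns_oo aK; apply/cvgrPdist_le => eps eps_gt0.
have [M leM] := ns_oo (Num.truncn (K / eps)).+1.
exists M => // m /= /leM le_ns.
have n_gt0 : 0 < (ns m)%:R :> R by rewrite ltr0n.
have -> : b - a m / (ns m)%:R = - (a m - b * (ns m)%:R) / (ns m)%:R.
  by rewrite opprB mulrBl mulfK // gt_eqF.
rewrite normrM normrN normfV (gtr0_norm n_gt0) ler_pdivrMr //.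
apply: le_trans (aK m) _; rewrite mulrC -ler_pdivrMr //.
by apply: ltW; apply: lt_le_trans (truncnS_gt _) _; rewrite ler_nat.
Qed.

Section FeasibleFlow.
Variables (R : realType) (k : nat).
Hypothesis k_gt0 : (0 < k)%N.

(** Passes an identity between edge counts, true up to a bounded error, to the limit; support,
    balance and total mass are all obtained this way. *)
Lemma limit_count (ns : nat -> nat) (sg : forall m, 'S_(ns m))
    (v : {ffun 'S_k -> R}) (P Q : pred 'S_k) (b K : R) :
  (forall m, (0 < ns m)%N) ->
  (forall N, exists M, forall m, (M <= m)%N -> (N <= ns m)%N) ->
  (forall p : 'S_k,
    ((fun m => (cocc p (sg m))%:R / (ns m)%:R : R) @ \oo --> v p)%classic) ->
  (forall m, `|(count P (walk k (oneline (sg m))))%:R -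
               (count Q (walk k (oneline (sg m))))%:R - b * (ns m)%:R| <= K) ->
  \sum_(p | P p) v p - \sum_(p | Q p) v p = b.
Proof.
move=> ns_gt0 ns_oo cvg_v boundK.
have cvg_sum (S : pred 'S_k) :
    ((fun m => (count S (walk k (oneline (sg m))))%:R / (ns m)%:R : R) @ \oo -->
     \sum_(p | S p) v p)%classic.
  have -> : (fun m => (count S (walk k (oneline (sg m))))%:R / (ns m)%:R : R) =
      (fun m => \sum_(p | S p) ((cocc p (sg m))%:R / (ns m)%:R)).
    apply/funext => m; rewrite -mulr_suml -sum_count_mem; congr (_ / _).
    by apply: eq_bigr => p _; rewrite cocc_walk.
  by apply: cvg_big => [|p _]; [exact: add_continuous | exact: cvg_v].
apply: (@cvg_unique _ (@norm_hausdorff _ R) _ _ _ _ (cvgB (cvg_sum P) (cvg_sum Q))).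
have -> : (fun m => (count P (walk k (oneline (sg m))))%:R / (ns m)%:R : R) -
    (fun m => (count Q (walk k (oneline (sg m))))%:R / (ns m)%:R : R) =
    (fun m => ((count P (walk k (oneline (sg m))))%:R -
      (count Q (walk k (oneline (sg m))))%:R) / (ns m)%:R).
  by apply/funext => m; rewrite mulrBl.
exact: cvg_quotient boundK.
Qed.

(** Sources sit at positions [0] to [N - 1] and targets at [1] to [N], so the two counts differ only
    by the end terms. *)
Lemma walk_balance u s : uniq s ->
  `|(count (fun p => ovsrc p == u) (walk k s))%:R -
    (count (fun p => ovtgt p == u) (walk k s))%:R| <= 1 :> R.
Proof.
move=> us; set N := ((size s).+1 - k)%N.
pose f i := std (window k.-1 i s) == u.
have -> : count (fun p => ovsrc p == u) (walk k s) = count f (iota 0 N).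
  by rewrite -(count_map (@ovsrc k) (pred1 u)) walk_src // count_map.
have -> : count (fun p => ovtgt p == u) (walk k s) = count f (iota 1 N).
  by rewrite -(count_map (@ovtgt k) (pred1 u)) walk_tgt // count_map.
have eqN : (count f (iota 0 N) + f N = f 0 + count f (iota 1 N))%N.
  by rewrite -[RHS]/(count f (iota 0 N.+1)) -addn1 iotaD count_cat /= addn0.
clearbody N; have := congr1 (fun n => n%:R : R) eqN; rewrite /= !natrD.
rewrite ler_norml; case: (f N); case: (f 0) => /=; lra.
Qed.

Lemma feasible_flow v : feasible R k v ->
  unit_flow (@ovsrc k) (@ovtgt k) (avoiding k) v.
Proof.
move=> [v_bound [ns [sg [ns_av [ns_oo cvg_v]]]]].
have ns_gt0 m : (0 < ns m)%N by case: (ns_av m).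
have av_sg m : all (avoiding k) (walk k (oneline (sg m))).
  apply: walk_avoiding (oneline_uniq _) _.
  by apply/avoids312P; case: (ns_av m).
have lim := limit_count ns_gt0 ns_oo cvg_v.
split=> [p|p nAp|u|].
- by case/andP: (v_bound p).
- have := lim (pred1 p) pred0 0 0; rewrite big_pred1_eq big_pred0 // subr0.
  apply=> m; rewrite count_pred0 (count_memPn _) ?subrr ?mul0r ?subr0 ?normr0 //.
  by apply: contraNN nAp => /(allP (av_sg m)).
- apply/eqP; rewrite -subr_eq0; apply/eqP.
  apply: (lim _ _ 0 1) => m; rewrite mul0r subr0.
  exact: walk_balance (oneline_uniq _).
(* A word of size [n] has [n + 1 - k] windows, truncated at 0, which is within [k] of [n]. *)
- have := lim predT pred0 1 k%:R; rewrite [X in _ - X]big_pred0 // subr0; apply=> m.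
  rewrite count_pred0 count_predT size_walk size_oneline mul1r subr0 distrC.
  have n_le : (ns m <= (ns m).+1 - k + k)%N by lia.
  have le_n : ((ns m).+1 - k <= ns m)%N by lia.
  rewrite -(ler_nat R) natrD in n_le; rewrite -(ler_nat R) in le_n.
  rewrite ler_norml; lra.
Qed.

End FeasibleFlow.

(** * Realizing unit flows by permutations *)

(** [mid] consists of the [k - 1] windows across the seam; every other window lies in one summand,
    where the shift preserves patterns. *)
Lemma walk_dsum k s t : (0 < k)%N -> (k.-1 <= size s)%N -> (k.-1 <= size t)%N ->
  exists2 mid, size mid = k.-1 & walk k (dsum s t) = walk k s ++ mid ++ walk k t.
Proof.
move=> k_gt0 le_s le_t.
exists [seq perm_of k (window k i (dsum s t)) | i <- iota ((size s).+1 - k) k.-1].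
  by rewrite size_map size_iota.
rewrite /walk size_dsum.
have -> : ((size s + size t).+1 - k = ((size s).+1 - k) + (k.-1 + ((size t).+1 - k)))%N.
  by lia.
rewrite !iotaD !map_cat add0n; congr (_ ++ (_ ++ _)).
  apply/eq_in_map => i; rewrite mem_iota add0n => /= li.
  have lt_is : (i < size s)%N by lia.
  by rewrite /window /dsum drop_cat lt_is takel_cat // size_drop; lia.
have -> : ((size s).+1 - k + k.-1 = size s + 0)%N by lia.
rewrite iotaDl -map_comp; apply/eq_in_map => i _ /=; apply: perm_of_std.
by rewrite /window addnC -drop_drop; apply/std_take/std_drop/std_dsum_drop.
Qed.

Lemma repeat_cycle (T : Type) (r : rel T) e c q : path.cycle r (e :: c) ->
  path r e (c ++ flatten (nseq q (e :: c))).
Proof.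
move=> cyc_c; have := cyc_c; rewrite /= rcons_path => /andP[path_c last_c].
by elim: q => [|q IHq] /=; rewrite ?cats0 // cat_path path_c /= last_c.
Qed.

Lemma count_repeat (T : Type) (a : pred T) q (c : seq T) :
  count a (flatten (nseq q c)) = (q * count a c)%N.
Proof. by elim: q => //= q IHq; rewrite count_cat IHq mulSn. Qed.

(** A walk of [L] edges needs [L + k - 1] letters; [q + 1] turns are made so that the walk is never
    empty. *)
Lemma realize_cycle k (c : seq 'S_k) q : (0 < k)%N ->
  closed_walk (@ovsrc k) (@ovtgt k) (avoiding k) c ->
  exists s, [/\ uniq s, av312 s, size s = (k.-1 + q.+1 * size c)%N &
    forall p, count_mem p (walk k s) = (q.+1 * count_mem p c)%N].
Proof.
case: k c => // k [|e c] _ [] // _ av_c cyc_c.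
have [||s [us avs szs ws]] := @lift_walk k e (c ++ flatten (nseq q (e :: c))).
- rewrite -cat_cons all_cat av_c /=.
  by elim: q => //= q IHq; move: av_c => /= /andP[-> ac]; rewrite all_cat ac IHq.
- exact: repeat_cycle cyc_c.
exists s; split=> //.
  rewrite szs size_cat size_flatten /shape map_nseq sumn_nseq /=.
  by rewrite mulSn mulnC; lia.
by move=> p; rewrite ws -cat_cons count_cat count_repeat mulSn.
Qed.

Section FlowFeasible.
Variables (R : realType) (k : nat).
Hypothesis k_gt0 : (0 < k)%N.

Let good (x : R * seq 'S_k) :=
  0 <= x.1 /\ closed_walk (@ovsrc k) (@ovtgt k) (avoiding k) x.2.

(** [K] must not depend on [N]. Each cycle adds to it [k] for the seam of the direct sum and
    [size c] for rounding the number of turns. *)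
Lemma approximate_sum (L : seq (R * seq 'S_k)) :
  (forall x, x \in L -> good x) ->
  exists K : R, forall N : nat, exists s, [/\ uniq s, av312 s, (k.-1 <= size s)%N,
    `|(size s)%:R - N%:R * \sum_(x <- L) x.1| <= K &
    forall p, `|(count_mem p (walk k s))%:R -
                N%:R * \sum_(x <- L) x.1 * freq R x.2 p| <= K].
Proof.
elim: L => [|[l c] L IHL] goodL.
  (* A word of size [k - 1] has no window, yet is long enough for [walk_dsum]. *)
  exists k%:R => N; exists (iota 0 k.-1).
  rewrite iota_uniq size_iota !big_nil mulr0 subr0; split=> //.
  - exact: av312_iota.
  - by rewrite ger0_norm ?ler_nat ?leq_pred.
  - move=> p; rewrite big_nil mulr0 subr0 /walk size_iota prednK // subnn /=.
    by rewrite normr0.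
have [] := goodL _ (mem_head _ _) => /= l_ge0 clos_c.
have [K approxL] := IHL (fun x xL => goodL x (mem_behead (s := (l, c) :: L) xL)).
exists (K + k%:R + (size c)%:R) => N; have [s [us avs le_s szs cnt_s]] := approxL N.
have szc : 0 < (size c)%:R :> R.
  by rewrite ltr0n lt0n size_eq0; apply/eqP; case: clos_c.
(* The ideal number of turns; with [q] its integer part, [q + 1] turns overshoot by at most one. *)
pose x : R := N%:R * l / (size c)%:R.
have x_ge0 : 0 <= x by rewrite divr_ge0 // mulr_ge0.
set q := Num.truncn x; have /andP[le_q lt_q] := truncn_itv x_ge0.
have [t [ut avt szt cnt_t]] := realize_cycle q k_gt0 clos_c.
have le_t : (k.-1 <= size t)%N by rewrite szt leq_addr.
have [mid szmid w_st] := walk_dsum k_gt0 le_s le_t.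
have xl : N%:R * l = x * (size c)%:R by rewrite /x divfK // gt_eqF.
exists (dsum s t); split.
- exact: dsum_uniq.
- exact: av312_dsum.
- by rewrite size_dsum (leq_trans le_s) // leq_addr.
- rewrite size_dsum natrD szt natrD natrM big_cons mulrDr xl.
  have le_k1 : k.-1%:R <= k%:R :> R by rewrite ler_nat leq_pred.
  have k1_ge0 : 0 <= k.-1%:R :> R by [].
  move: szs; rewrite !ler_norml => /andP[sz1 sz2].
  have q1 : x * (size c)%:R <= q.+1%:R * (size c)%:R by rewrite ler_pM2r // ltW.
  have q2 : q.+1%:R * (size c)%:R <= x * (size c)%:R + (size c)%:R.
    by rewrite -[in X in _ + X](mul1r (size c)%:R) -mulrDl ler_pM2r // -natr1 lerD2r.
  by rewrite /q in q1 q2 *; apply/andP; split; lra.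
- move=> p; rewrite w_st !count_cat !natrD cnt_t natrM big_cons mulrDr /= ffunE.
  have cnt_le : (count_mem p c)%:R <= (size c)%:R :> R by rewrite ler_nat count_size.
  have cnt_ge0 : 0 <= (count_mem p c)%:R :> R by [].
  have mid_le : (count_mem p mid)%:R <= k%:R :> R.
    by rewrite ler_nat (leq_trans (count_size _ _)) // szmid leq_pred.
  have mid_ge0 : 0 <= (count_mem p mid)%:R :> R by [].
  have -> : N%:R * (l * ((count_mem p c)%:R / (size c)%:R)) = x * (count_mem p c)%:R.
    by rewrite /x !mulrA mulrAC.
  have := cnt_s p; rewrite !ler_norml => /andP[c1 c2].
  have q1 : x * (count_mem p c)%:R <= q.+1%:R * (count_mem p c)%:R.
    by rewrite ler_wpM2r // ltW.
  have q2 : q.+1%:R * (count_mem p c)%:R <= x * (count_mem p c)%:R + (count_mem p c)%:R.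
    rewrite -[in X in _ + X](mul1r (count_mem p c)%:R) -mulrDl.
    by rewrite ler_wpM2r // -natr1 lerD2r.
  by apply/andP; split; lra.
Qed.

Lemma flow_feasible v : unit_flow (@ovsrc k) (@ovtgt k) (avoiding k) v ->
  feasible R k v.
Proof.
move=> flow_v; have [v_ge0 _ _ sum_v] := flow_v.
have v_le1 p : v p <= 1.
  by rewrite -sum_v (bigD1 p) //= lerDl sumr_ge0.
have [m [P [l [P_simple [l_ge0 [sum_l vE]]]]]] := (unit_flow_conv _ _ _ _).1 flow_v.
have [c cP] := choice P_simple.
pose L := [seq (l i, c i) | i <- enum 'I_m].
have [|K approxL] := @approximate_sum L.
  move=> _ /mapP[i _ ->]; split; first exact: l_ge0.
  by have [/simple_cycle_closed] := cP i.
have sumL : \sum_(x <- L) x.1 = 1 by rewrite big_map big_enum.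
have vL p : \sum_(x <- L) x.1 * freq R x.2 p = v p.
  rewrite vE sum_scale_ffunE big_map big_enum; apply: eq_bigr => i _ /=.
  by have [_ ->] := cP i.
have approx N : exists s, [/\ uniq s, av312 s, (N < size s)%N &
    forall p, `|(count_mem p (walk k s))%:R - v p * (size s)%:R| <= K + K].
  (* The extra integer exceeds [K], so the size stays above [N] despite the error. *)
  have [s [us avs _ szs cnt_s]] := approxL (N + (Num.truncn K).+1)%N.
  exists s; split=> //.
    move: szs; rewrite sumL mulr1 ler_norml => /andP[sz1 _].
    have := truncnS_gt K; rewrite -(ltr_nat R) => ?.
    by move: sz1; rewrite natrD; lra.
  move=> p; have := cnt_s p; rewrite vL; move: szs; rewrite sumL mulr1.
  set M := (N + _)%:R => szs cnt.
  (* One [K] comes from the counts, the other from the size, scaled by [v p <= 1]. *)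
  have -> : (count_mem p (walk k s))%:R - v p * (size s)%:R =
      ((count_mem p (walk k s))%:R - M * v p) + v p * (M - (size s)%:R) :> R.
    by rewrite mulrBr (mulrC M); lra.
  apply: le_trans (ler_normD _ _) _; apply: lerD => //.
  rewrite normrM distrC (ger0_norm (v_ge0 p)) -[leRHS]mul1r.
  by apply: ler_pM.
have [s sP] := choice approx.
have us N : uniq (s N) by case: (sP N).
split=> [p|]; first by rewrite v_ge0 v_le1.
have sgE N : oneline (perm_of (size (s N)) (s N)) = std (s N) by rewrite perm_ofK.
exists (fun N => size (s N)), (fun N => perm_of (size (s N)) (s N)); split; [|split].
- move=> N; have [_ avs lt_s _] := sP N; split; first exact: leq_ltn_trans lt_s.
  by apply/avoids312P; rewrite sgE; apply/av312_std.
- move=> N; exists N => N' le_N; have [_ _ lt_s _] := sP N'.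
  exact: leq_trans le_N (ltnW lt_s).
- move=> p; apply: (cvg_quotient (K := K + K)) => [N|N|N].
  + by have [_ _ lt_s _] := sP N; apply: leq_ltn_trans lt_s.
  + exists N => N' le_N; have [_ _ lt_s _] := sP N'.
    exact: leq_trans le_N (ltnW lt_s).
  + by rewrite cocc_walk sgE (walk_std k (std_idem _)); case: (sP N).
Qed.

End FlowFeasible.

(** * Connectivity of the overlap graph *)

Lemma window_connected (T : Type) k (phi : seq nat -> T) s : (0 < k)%N ->
  uniq s -> av312 s ->
  (forall e : 'S_k, avoiding k e -> phi (ovsrc e) = phi (ovtgt e)) ->
  forall i, (i <= (size s).+1 - k)%N ->
    phi (std (window k.-1 0 s)) = phi (std (window k.-1 i s)).
Proof.
move=> k_gt0 us avs phi_e; elim=> // i IHi lt_i; rewrite IHi ?(ltnW lt_i) //.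
rewrite -ovsrc_window // -ovtgt_window //; apply: phi_e.
apply: (allP (walk_avoiding k us avs)); apply/mapP; exists i => //.
by rewrite mem_iota.
Qed.

(* The windows of [e (+) e] travel from [e] back to [e]. *)
Lemma exists_closed_walk k (e : 'S_k) : (0 < k)%N -> avoiding k e ->
  exists2 c, closed_walk (@ovsrc k) (@ovtgt k) (avoiding k) c & e \in c.
Proof.
move=> k_gt0 ave; have /av312P avo := ave.
set s := dsum (oneline e) (oneline e).
have us : uniq s by rewrite dsum_uniq ?oneline_uniq.
have avs : av312 s by apply: av312_dsum.
have szs : size s = (k + k)%N by rewrite size_dsum !size_oneline.
have szw : size (walk k s) = k.+1 by rewrite size_walk szs; lia.
have w0 : nth e (walk k s) 0 = e.
  rewrite nth_walk ?szs; last by lia.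
  apply: perm_of_oneline; rewrite /window drop0 takel_cat ?size_oneline //.
  by rewrite take_oversize ?std_oneline ?size_oneline.
have wk : nth e (walk k s) k = e.
  rewrite nth_walk ?szs; last by lia.
  apply: perm_of_oneline; rewrite /window take_oversize; last first.
    by rewrite size_drop szs; lia.
  by rewrite -{1}(size_oneline e) std_dsum_drop std_oneline.
have := walk_sorted k_gt0 us; have := walk_avoiding k us avs.
case: (walk k s) szw w0 wk => // f w [szw] /= -> wk.
(* The last of the [k + 1] windows is [e] again; dropping it closes the walk. *)
case/lastP: w szw wk => [sz0|w g szw]; first by rewrite -sz0 in k_gt0.
have gE n : size (rcons w g) = n -> nth e (e :: rcons w g) n = g.
  by move=> <-; rewrite -last_nth last_rcons.
rewrite (gE _ szw) => -> /andP[_]; rewrite all_rcons => /andP[_ avw] path_w.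
exists (e :: w); last exact: mem_head.
by split=> //=; rewrite ave.
Qed.

Lemma std_iota m n : std (iota m n) = iota 0 n.
Proof.
rewrite -[m in LHS]addn0 iotaDl std_map; last by move=> x y; rewrite ltn_add2l.
exact: (std_perm_iota (perm_refl _)).
Qed.

(** Listing the vertices as stack outputs gives membership, distinctness and the Catalan length
    together. *)
Definition vertices k := stack_outputs k.-1 0 [::].

Lemma mem_vertices k o :
  (o \in vertices k) = perm_eq o (iota 0 k.-1) && av312b o.
Proof. by rewrite mem_stack_outputs // dec_below0. Qed.

Lemma std_vertex k s : uniq s -> av312 s -> size s = k.-1 -> std s \in vertices k.
Proof.
move=> us avs szs; rewrite mem_vertices -(perm_ofK us szs) oneline_perm.
by rewrite perm_ofK //; apply/av312P/av312_std.
Qed.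

Lemma ovsrc_vertex k (e : 'S_k) : avoiding k e -> ovsrc e \in vertices k.
Proof.
move=> /av312P ave; apply: std_vertex.
- by rewrite take_uniq ?oneline_uniq.
- exact: av312_take.
- by rewrite size_takel ?size_oneline ?leq_pred.
Qed.

Lemma ovtgt_vertex k (e : 'S_k) : avoiding k e -> ovtgt e \in vertices k.
Proof.
move=> /av312P ave; apply: std_vertex.
- by rewrite drop_uniq ?oneline_uniq.
- exact: av312_drop.
- by rewrite size_drop size_oneline subn1.
Qed.

(** The increasing permutation supplies the loop at the root for the rank computation. *)
Lemma identity_loop k : (0 < k)%N -> exists2 e : 'S_k, avoiding k e &
  ovsrc e = iota 0 k.-1 /\ ovtgt e = iota 0 k.-1.
Proof.
move=> k_gt0; have oE : oneline (perm_of k (iota 0 k)) = iota 0 k.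
  by rewrite perm_ofK ?iota_uniq ?size_iota // std_iota.
exists (perm_of k (iota 0 k)).
  by rewrite /avoiding oE; apply/av312P/av312_iota.
rewrite /ovsrc /ovtgt oE take_iota drop_iota !std_iota subn1.
by rewrite (minn_idPl (leq_pred k)).
Qed.

(** The windows of the direct sum of [u] and an increasing word lead from [u] to the root. *)
Lemma overlap_connected (T : Type) k (phi : seq nat -> T) : (0 < k)%N ->
  (forall e : 'S_k, avoiding k e -> phi (ovsrc e) = phi (ovtgt e)) ->
  forall u, u \in vertices k -> phi u = phi (iota 0 k.-1).
Proof.
move=> k_gt0 phi_e u; rewrite mem_vertices => /andP[eq_u /av312P avu].
have szu : size u = k.-1 by rewrite (perm_size eq_u) size_iota.
have uu : uniq u by rewrite (perm_uniq eq_u) iota_uniq.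
pose s := dsum u (iota 0 k.-1).
have szs : size s = (k.-1 + k.-1)%N by rewrite size_dsum szu size_iota.
have := window_connected k_gt0 (dsum_uniq uu (iota_uniq 0 k.-1))
  (av312_dsum avu (@av312_iota 0 k.-1)) phi_e (i := k.-1).
rewrite -/s szs /window drop0 takel_cat ?szu // take_oversize ?szu //.
rewrite (std_perm_iota eq_u) => ->; last by lia.
rewrite take_oversize ?size_drop ?szs ?addnK // -{1}szu std_dsum_drop.
by rewrite std_iota.
Qed.

(** Averages, over all edges, the frequencies of a closed walk through that edge. *)
Lemma positive_flow (R : realType) k : (0 < k)%N ->
  exists2 w : {ffun 'S_k -> R}, unit_flow (@ovsrc k) (@ovtgt k) (avoiding k) w &
    forall e, avoiding k e -> 0 < w e.
Proof.
move=> k_gt0; have [e0 ave0 _] := identity_loop k_gt0.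
pose n := #|avoiding k|.
have n_gt0 : (0 < n)%N by apply/card_gt0P; exists e0.
have nR : 0 < n%:R :> R by rewrite ltr0n.
pose edge (i : 'I_n) : 'S_k := enum_val i.
have edge_av i : avoiding k (edge i) := enum_valP i.
have closed_walks i : exists c,
    closed_walk (@ovsrc k) (@ovtgt k) (avoiding k) c /\ edge i \in c.
  by have [c] := exists_closed_walk k_gt0 (edge_av i); exists c.
have [c cP] := choice closed_walks.
pose w := \sum_(i < n) (n%:R^-1 : R) *: freq R (c i).
exists w.
  apply: (@conv_unit_flow _ _ _ _ _ _ (fun x => exists i, x = freq R (c i))).
    by move=> _ [i ->]; apply: freq_flow; have [] := cP i.
  exists n, (fun i => freq R (c i)), (fun=> n%:R^-1); split; first by move=> i; exists i.
  split; first by move=> i; rewrite invr_ge0 ltW.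
  by rewrite sumr_const card_ord -[_ *+ _]mulr_natr mulVf ?gt_eqF.
move=> e ave; rewrite sum_scale_ffunE.
have freq_ge0 i : 0 <= freq R (c i) e by rewrite ffunE divr_ge0.
rewrite (bigD1 (enum_rank_in ave e)) //= ltr_wpDr //.
  by apply: sumr_ge0 => i _; rewrite mulr_ge0 // invr_ge0 ltW.
set i := enum_rank_in _ _; have [_] := cP i.
rewrite /edge enum_rankK_in // => ec.
rewrite mulr_gt0 ?invr_gt0 // ffunE divr_gt0 // ltr0n.
  by rewrite -has_count has_pred1.
by case: (c i) ec.
Qed.

Theorem mainTheorem3 (R : realType) (k : nat) : (1 <= k)%N ->
  [/\ feasible R k = cycle_polytope R k,
      affdim (feasible R k) (catalan k - catalan k.-1)%N &
      forall x : {ffun 'S_k -> R}, is_vertex (feasible R k) x <->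
        exists c, simple_cycle k c /\ x = e_cycle R k c].
Proof.
move=> k_gt0.
have feasibleE : feasible R k =
    (unit_flow (@ovsrc k) (@ovtgt k) (avoiding k) : set {ffun 'S_k -> R}).
  apply/seteqP; split=> v; [exact: feasible_flow | exact: flow_feasible].
have simpleE c : simple_cycle k c <->
    simple_cycle_in (@ovsrc k) (@ovtgt k) (avoiding k) c.
  split=> -[c0 avc cyc_c uc]; split=> //.
    by apply/allP => e /avc/avoidingP.
  by move=> e /(allP avc)/avoidingP.
have freqsE (x : {ffun 'S_k -> R}) :
    (exists c, simple_cycle k c /\ x = e_cycle R k c) <->
    simple_freqs (@ovsrc k) (@ovtgt k) (avoiding k) x.
  by split=> -[c [/simpleE simple_c ->]]; exists c.
split; rewrite feasibleE.
- rewrite /cycle_polytope; set S := (X in Defs.conv X).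
  have -> : S = simple_freqs (@ovsrc k) (@ovtgt k) (avoiding k).
    by apply/seteqP; split=> x /freqsE.
  by apply/seteqP; split=> v /unit_flow_conv.
(* The two Catalan numbers become the number of edges and the length of the vertex list. *)
- rewrite -(card_av312 k) -[catalan k.-1]size_stack_outputs0.
  have [w flow_w w_gt0] := positive_flow R k_gt0.
  apply: (@affdim_unit_flow R _ _ _ _ _ (vertices k) (iota 0 k.-1) _ _ _ _ _ _ w) => //.
  + exact: uniq_stack_outputs.
  + exact: ovsrc_vertex.
  + exact: ovtgt_vertex.
  + by rewrite mem_vertices perm_refl; apply/av312P/av312_iota.
  + exact: identity_loop.
  + by move=> phi; apply: overlap_connected.
- by move=> x; rewrite unit_flow_vertex freqsE.
Qed.
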